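(* Fix $\ell\ge 3$ and for each $m$ let $\mathbf D_m=(D^{(1)}(m),\dots,D^{(\ell)}(m))$ be a collection of $\ell$ independent random dice, with $D^{(k)}(m)$ having $n_k(m)=f_k(m)\,m\le m$ faces. Suppose that for each $k=1,\dots,\ell$, as $m\to\infty$, (i) $f_k(m)\to f_k(\infty)\in(0,1]$; (ii) $\mathbf p_k(m)\to\mathbf p_k(\infty)\in(0,1]$, $\sigma_k(m)\to\sigma_k(\infty)\in(0,\infty)$, and $\gamma_k(m)\to\gamma_k(\infty)\in[-1,1]$; (iii) $\mathbb P\big(D^{(k)}_1(m)=D^{(k+1)}_1(m)\big)\to0$; (iv) $\frac12-\mathbf p_k-\frac12\,\mathbb P\big(D^{(k)}_1=D^{(k+1)}_1\big)=o(m^{-1/2})$; (v) $\mathbf p_k\to\frac12$, $\mathbf q_k\to\frac13$, $\mathbf r_k\to\frac13$ and $\mathbf s_k\to\frac16$. Then $$\lim_{m\to\infty}\mathbb P\big(D^{(1)}\triangleright D^{(2)}\triangleright\cdots\triangleright D^{(\ell)}\triangleright D^{(1)}\big)=0.$$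
   Context: Indices of dice are cyclic modulo $\ell$: $D^{(0)}=D^{(\ell)}$, $D^{(\ell+1)}=D^{(1)}$, and likewise for all quantities indexed by $k$. A random die with $n$ faces and law $\mathcal L$ is a vector $D=(D_1,\dots,D_n)$ of i.i.d. real random variables with law $\mathcal L$. Dice in a collection are independent if all the random variables $\{D^{(k)}_i\}_{k,i}$ are mutually independent. For each $m$, the die $D^{(k)}=D^{(k)}(m)$ has some law $\mathcal L^{(k)}_m$, which may depend on both $k$ and $m$, and $n_k=n_k(m)\le m$ faces; $f_k=f_k(m)=n_k/m$. Dependence on $m$ is often omitted. For dice (vectors) $A,B$, $A\triangleright B$ means $\#\{(i,j):A_i>B_j\}>\#\{(i,j):B_j>A_i\}$. In the following four probabilities, $D^{(k)}_1,D^{(k)}_2$ stand for independent variables with law $\mathcal L^{(k)}_m$ (independent across dice): $\mathbf p_k=\mathbb P(D^{(k)}_1>D^{(k+1)}_1)$; $\mathbf q_k=\mathbb P(D^{(k)}_1>D^{(k+1)}_1,\ D^{(k)}_2>D^{(k+1)}_1)$; $\mathbf r_k=\mathbb P(D^{(k)}_1>D^{(k+1)}_1,\ D^{(k)}_1>D^{(k+1)}_2)$; $\mathbf s_k=\mathbb P(D^{(k-1)}_1>D^{(k)}_1>D^{(k+1)}_1)$. $\sigma_k=\big[f_kf_{k+1}\big(f_k(\mathbf q_k-\mathbf p_k^2)+f_{k+1}(\mathbf r_k-\mathbf p_k^2)\big)\big]^{1/2}$ and $\gamma_k=\dfrac{1}{\sigma_{k-1}\sigma_k}f_{k-1}f_kf_{k+1}(\mathbf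 s_k-\mathbf p_{k-1}\mathbf p_k)$. All of these depend on $m$. *)

(* Defs.v *)
From HB Require Import structures.
From mathcomp Require Export all_boot all_order all_algebra.
From mathcomp Require Export all_classical all_reals all_analysis.
Export Order.TTheory GRing.Theory Num.Theory.
Export numFieldNormedType.Exports.

Set Implicit Arguments.
Unset Strict Implicit.
Unset Printing Implicit Defensive.

Local Open Scope classical_set_scope.
Local Open Scope ring_scope.

Definition die_beats (R : realType) (a b : nat) (A : 'I_a -> R) (B : 'I_b -> R)
  : bool :=
  (#|[pred ij : 'I_a * 'I_b | (B ij.2 > A ij.1)%R]|
     < #|[pred ij : 'I_a * 'I_b | (A ij.1 > B ij.2)%R]|)%N.

Definition mutually_independent (R : realType) (d : measure_display)
    (T : measurableType d) (P : probability T R) (I : finType)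
    (X : I -> T -> R) : Prop :=
  forall (J : {set I}) (A : I -> set R),
    (forall i, i \in J -> measurable (A i)) ->
    P (\bigcap_(i in [set` J]) (X i @^-1` A i)) =
      (\prod_(i in J) P (X i @^-1` A i))%E.

(* Equality is only required on measurable sets: a [probability] record is a
   function on all subsets, with arbitrary values off the sigma-algebra. *)
Definition has_law (R : realType) (d : measure_display) (T : measurableType d)
    (P : probability T R) (X : {RV P >-> R})
    (L : probability R R) : Prop :=
  forall A : set R, measurable A -> distribution P X A = L A.

(* Independence is joint over all pairs (die, face), so it covers both the
   faces within a die and the dice themselves. *)
Definition independent_random_dice (R : realType) (d : measure_display)
    (T : measurableType d) (P : probability T R) (l : nat) (n : 'I_l -> nat)
    (L : 'I_l -> probability R R)
    (D : forall k : 'I_l, 'I_(n k) -> {RV P >-> R}) : Prop :=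
  (forall k i, has_law (D k i) (L k)) /\
  mutually_independent P
    (fun ki : {k : 'I_l & 'I_(n k)} => D (tag ki) (tagged ki) : T -> R).

(* Dice are numbered from 0; the cyclic successor and predecessor of [k] are
   [ordS k] and [ord_pred k].  Independent variables with prescribed laws are
   rendered as the coordinates under the product of these laws. *)
Section parameters.
Context {R : realType} {l : nat}.
Variables (f : 'I_l -> R) (L : 'I_l -> probability R R).

Definition pwin (k : 'I_l) : R :=
  fine ((L k \x L (ordS k))%E [set x | x.1 > x.2]).

Definition ptie (k : 'I_l) : R :=
  fine ((L k \x L (ordS k))%E [set x | x.1 = x.2]).

(* coordinates: (D^(k)_1, D^(k)_2), D^(k+1)_1 *)
Definition qwin (k : 'I_l) : R :=
  fine (((L k \x L k) \x L (ordS k))%E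
    [set x | x.1.1 > x.2 /\ x.1.2 > x.2]).

(* coordinates: (D^(k)_1, D^(k+1)_1), D^(k+1)_2 *)
Definition rwin (k : 'I_l) : R :=
  fine (((L k \x L (ordS k)) \x L (ordS k))%E
    [set x | x.1.1 > x.1.2 /\ x.1.1 > x.2]).

(* coordinates: (D^(k-1)_1, D^(k)_1), D^(k+1)_1 *)
Definition swin (k : 'I_l) : R :=
  fine (((L (ord_pred k) \x L k) \x L (ordS k))%E
    [set x | x.1.1 > x.1.2 /\ x.1.2 > x.2]).

Definition sigma (k : 'I_l) : R :=
  Num.sqrt (f k * f (ordS k) *
    (f k * (qwin k - pwin k ^+ 2) + f (ordS k) * (rwin k - pwin k ^+ 2))).

Definition gamma (k : 'I_l) : R :=
  (sigma (ord_pred k) * sigma k)^-1 *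
    (f (ord_pred k) * f k * f (ordS k) *
      (swin k - pwin (ord_pred k) * pwin k)).

End parameters.

(* Main.v *)
(** Write [W k] for the normalized score of the duel of die [k] against die
    [k+1], and [adv M x] for the mean of [sgn (x - Y)] when [Y] has law [M].
    Up to a completely degenerate U-statistic, of variance [O(m^-2)], the
    Hoeffding decomposition makes [W k] the sum of the mean of [adv L(k+1)] over
    the faces of die [k] and of the mean of [- adv L(k)] over the faces of die
    [k+1].  In the cyclic sum of the [W k], the faces of die [k] thus carry
    [adv L(k+1) - adv L(k-1)], and the limits of [p, q, r, s] say exactly that
    the second moment of this function tends to 0, so that the sum is
    [o(m^-1/2)] in mean square.  If every die beats the next one, all the [W k]
    are positive, so a single one of them is squeezed in an interval of length
    [o(m^-1/2)].  This has vanishing probability: the linear part of [W k] is a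
    sum of independent variables whose characteristic function at a frequency
    of order [sqrt m] is small, and a Fejer-type average of cosines turns this
    into a small ball estimate, so no central limit theorem is needed. *)
From HB Require Import structures.
Require Import Defs.
From mathcomp Require Import measurable_realfun ring lra.

Set Implicit Arguments.
Unset Strict Implicit.
Unset Printing Implicit Defensive.

Local Open Scope classical_set_scope.
Local Open Scope ring_scope.

(** * Expectations of bounded measurable functions *)

Section bounded_measurable.
Context {R : realType} d {T : measurableType d}.
Implicit Types f g : T -> R.

(** This class is stable under ring operations and finite sums, and its members are integrable for
    every probability, so linearity, monotonicity and Fubini apply without integrability
    conditions. *)
Definition bmeas f := measurable_fun setT f /\ exists M, forall x, `|f x| <= M.

Lemma bmeas_cst c : bmeas (fun _ => c).
Proof. by split; [exact: measurable_cst|exists `|c|]. Qed.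

Lemma bmeasD f g : bmeas f -> bmeas g -> bmeas (fun x => f x + g x).
Proof.
move=> [mf [M fM]] [mg [N gN]]; split; first exact: measurable_funD.
by exists (M + N) => x; rewrite (le_trans (ler_normD _ _))// lerD.
Qed.

Lemma bmeasM f g : bmeas f -> bmeas g -> bmeas (fun x => f x * g x).
Proof.
move=> [mf [M fM]] [mg [N gN]]; split; first exact: measurable_funM.
by exists (M * N) => x; rewrite normrM ler_pM.
Qed.

Lemma bmeasN f : bmeas f -> bmeas (fun x => - f x).
Proof.
move=> bf; rewrite (_ : (fun _ => _) = (fun x => (-1) * f x)).
  by apply: bmeasM => //; exact: bmeas_cst.
by apply/funext => x; rewrite mulN1r.
Qed.

Lemma bmeasB f g : bmeas f -> bmeas g -> bmeas (fun x => f x - g x).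
Proof. by move=> bf bg; apply: bmeasD => //; exact: bmeasN. Qed.

Lemma bmeasX f n : bmeas f -> bmeas (fun x => f x ^+ n).
Proof.
move=> bf; elim: n => [|n IHn]; first exact: bmeas_cst.
rewrite (_ : (fun x => f x ^+ n.+1) = (fun x => f x * f x ^+ n)).
  exact: bmeasM.
by apply/funext => x; rewrite exprS.
Qed.

Lemma bmeas_sum (I : Type) (s : seq I) (p : pred I) (F : I -> T -> R) :
  (forall i, p i -> bmeas (F i)) -> bmeas (fun x => \sum_(i <- s | p i) F i x).
Proof.
move=> bF; elim: s => [|i s IHs].
  rewrite (_ : (fun _ => _) = fun _ => 0); first exact: bmeas_cst.
  by apply/funext => x; rewrite big_nil.
rewrite (_ : (fun _ => _) = fun x => if p i then F i x + \sum_(j <- s | p j) F j x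
    else \sum_(j <- s | p j) F j x); last by apply/funext => x; rewrite big_cons.
by case: (boolP (p i)) => pi //; apply: bmeasD => //; exact: bF.
Qed.

Lemma bmeas_indic (A : set T) : measurable A -> bmeas (\1_A : T -> R).
Proof.
move=> mA; split; first exact: measurable_indic.
by exists 1 => x; rewrite indicE; case: (_ \in _); rewrite ?normr1// normr0.
Qed.

End bounded_measurable.

Lemma bmeas_comp (R : realType) d1 d2 (T1 : measurableType d1)
    (T2 : measurableType d2) (f : T2 -> R) (g : T1 -> T2) :
  measurable_fun setT g -> bmeas f -> bmeas (fun x => f (g x)).
Proof.
move=> mg [mf [M fM]]; split; first exact: (measurableT_comp mf mg).
by exists M.
Qed.

Definition Ex (R : realType) d (T : measurableType d) (P : probability T R)
  (f : T -> R) : R := \int[P]_x f x.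

Section expectation.
Context {R : realType} d {T : measurableType d} (P : probability T R).
Implicit Types f g : T -> R.

Lemma bmeas_integrable f : bmeas f -> P.-integrable setT (EFin \o f).
Proof.
move=> [mf [M fM]]; apply: measurable_bounded_integrable => //.
  exact: (le_lt_trans (probability_le1 P measurableT) (ltry 1)).
by exists M; split; rewrite ?num_real// => N MN x _; exact: (le_trans (fM x) (ltW MN)).
Qed.

Lemma Ex_cst c : Ex P (fun _ => c) = c.
Proof. by rewrite /Ex Rintegral_cst// [X in fine X](probability_setT P) mulr1. Qed.

Lemma ExD f g : bmeas f -> bmeas g ->
  Ex P (fun x => f x + g x) = Ex P f + Ex P g.
Proof. by move=> bf bg; rewrite /Ex RintegralD//; exact: bmeas_integrable. Qed.

Lemma ExZ c f : bmeas f -> Ex P (fun x => c * f x) = c * Ex P f.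
Proof. by move=> bf; rewrite /Ex RintegralZl//; exact: bmeas_integrable. Qed.

Lemma ExN f : bmeas f -> Ex P (fun x => - f x) = - Ex P f.
Proof.
move=> bf; rewrite -mulN1r -ExZ//; congr Ex.
by apply/funext => x; rewrite mulN1r.
Qed.

Lemma ExB f g : bmeas f -> bmeas g ->
  Ex P (fun x => f x - g x) = Ex P f - Ex P g.
Proof. by move=> bf bg; rewrite ExD ?ExN//; exact: bmeasN. Qed.

Lemma Ex_sum (I : Type) (s : seq I) (p : pred I) (F : I -> T -> R) :
  (forall i, p i -> bmeas (F i)) ->
  Ex P (fun x => \sum_(i <- s | p i) F i x) = \sum_(i <- s | p i) Ex P (F i).
Proof.
move=> bF; elim: s => [|i s IHs].
  rewrite big_nil -[RHS](Ex_cst 0); congr Ex.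
  by apply/funext => x; rewrite big_nil.
rewrite (_ : (fun _ => _) = fun x => if p i then F i x + \sum_(j <- s | p j) F j x
    else \sum_(j <- s | p j) F j x); last by apply/funext => x; rewrite big_cons.
rewrite big_cons -IHs; case: (boolP (p i)) => pi //.
by rewrite ExD//; [exact: bF|exact: bmeas_sum].
Qed.

Lemma le_Ex f g : bmeas f -> bmeas g -> (forall x, f x <= g x) ->
  Ex P f <= Ex P g.
Proof. by move=> bf bg fg; apply: le_Rintegral => //; exact: bmeas_integrable. Qed.

Lemma Ex_ge0 f : (forall x, 0 <= f x) -> 0 <= Ex P f.
Proof. by move=> f0; apply: Rintegral_ge0. Qed.

Lemma Ex_indic (A : set T) : measurable A -> Ex P (\1_A) = fine (P A).
Proof. by move=> mA; rewrite /Ex /Rintegral integral_indic// setIT. Qed.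

Lemma Ex_le_cst f c : bmeas f -> (forall x, f x <= c) -> Ex P f <= c.
Proof. by move=> bf fc; rewrite -[leRHS]Ex_cst le_Ex//; exact: bmeas_cst. Qed.

Lemma norm_Ex_le f g : bmeas f -> bmeas g -> (forall x, `|f x| <= g x) ->
  `|Ex P f| <= Ex P g.
Proof.
move=> bf bg fg; rewrite ler_norml -ExN//; apply/andP; split; apply: le_Ex => //.
- exact: bmeasN.
- by move=> x; have := fg x; rewrite ler_norml => /andP[].
- by move=> x; have := fg x; rewrite ler_norml => /andP[].
Qed.

Lemma Ex_sqr_centered f : bmeas f ->
  Ex P (fun x => (f x - Ex P f) ^+ 2) = Ex P (fun x => f x ^+ 2) - Ex P f ^+ 2.
Proof.
move=> bf; set e := Ex P f.
transitivity (Ex P (fun x => f x ^+ 2 + ((- 2 * e) * f x + e ^+ 2))).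
  by congr Ex; apply/funext => x; ring.
rewrite ExD; [|exact: bmeasX|]; last first.
  by apply: bmeasD; [apply: bmeasM => //; exact: bmeas_cst|exact: bmeas_cst].
rewrite ExD; [|by apply: bmeasM => //; exact: bmeas_cst|exact: bmeas_cst].
by rewrite ExZ// Ex_cst -/e; ring.
Qed.

Lemma sqr_Ex_le f : bmeas f -> Ex P f ^+ 2 <= Ex P (fun x => f x ^+ 2).
Proof.
move=> bf; rewrite -subr_ge0 -Ex_sqr_centered//.
by apply: Ex_ge0 => x; exact: sqr_ge0.
Qed.

End expectation.

(** * Iterated expectations, image laws and freezing of an independent variable *)

Section product_expectation.
Context {R : realType} d1 d2 {T1 : measurableType d1} {T2 : measurableType d2}.
Variables (P1 : probability T1 R) (P2 : probability T2 R).
Implicit Type F : T1 * T2 -> R.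


Lemma bmeas_section1 F y : bmeas F -> bmeas (fun x => F (x, y)).
Proof. by move=> bF; apply: bmeas_comp bF; exact: pair2_measurable. Qed.

Lemma bmeas_section2 F x : bmeas F -> bmeas (fun y => F (x, y)).
Proof. by move=> bF; apply: bmeas_comp bF; exact: pair1_measurable. Qed.

Lemma bmeas_Ex1 F : bmeas F -> bmeas (fun y => Ex P1 (fun x => F (x, y))).
Proof.
move=> bF; have [_ [M FM]] := bF; split; last first.
  exists M => y; rewrite -[leRHS](Ex_cst P1 M).
  by apply: norm_Ex_le => //; [exact: bmeas_section1|exact: bmeas_cst].
apply/measurable_EFinP; rewrite (_ : _ \o _ = fubini_G P1 (EFin \o F)).
  by apply: (measurable_fubini_G (m2 := P2)); exact: bmeas_integrable.
apply/funext => y /=; rewrite /Ex /Rintegral fineK//.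
by apply: integrable_fin_num => //; exact/bmeas_integrable/bmeas_section1.
Qed.

Lemma bmeas_Ex2 F : bmeas F -> bmeas (fun x => Ex P2 (fun y => F (x, y))).
Proof.
move=> bF; have [_ [M FM]] := bF; split; last first.
  exists M => y; rewrite -[leRHS](Ex_cst P2 M).
  by apply: norm_Ex_le => //; [exact: bmeas_section2|exact: bmeas_cst].
apply/measurable_EFinP; rewrite (_ : _ \o _ = fubini_F P2 (EFin \o F)).
  by apply: (measurable_fubini_F (m1 := P1)); exact: bmeas_integrable.
apply/funext => y /=; rewrite /Ex /Rintegral fineK//.
by apply: integrable_fin_num => //; exact/bmeas_integrable/bmeas_section2.
Qed.

Lemma Ex_prod1 F : bmeas F ->
  Ex (P1 \x P2)%E F = Ex P1 (fun x => Ex P2 (fun y => F (x, y))).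
Proof.
move=> bF; rewrite [LHS]/Ex /Rintegral -integral12_prod_meas1; last exact: bmeas_integrable.
rewrite [RHS]/Ex /Rintegral; congr fine; apply: eq_integral => x _.
rewrite /Ex /Rintegral fineK//.
by apply: integrable_fin_num => //; exact/bmeas_integrable/bmeas_section2.
Qed.

Lemma Ex_prod2 F : bmeas F ->
  Ex (P1 \x P2)%E F = Ex P2 (fun y => Ex P1 (fun x => F (x, y))).
Proof.
move=> bF; rewrite [LHS]/Ex /Rintegral -integral21_prod_meas1; last exact: bmeas_integrable.
rewrite [RHS]/Ex /Rintegral; congr fine; apply: eq_integral => x _.
rewrite /Ex /Rintegral fineK//.
by apply: integrable_fin_num => //; exact/bmeas_integrable/bmeas_section1.
Qed.

End product_expectation.

Section law.
Context {R : realType} d d1 {T : measurableType d} {S : measurableType d1}.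

Lemma eq_Ex_measure (P Q : probability T R) (f : T -> R) :
  (forall A, measurable A -> P A = Q A) -> Ex P f = Ex Q f.
Proof.
by move=> PQ; congr fine; apply: eq_measure_integral => A mA _; exact: PQ.
Qed.

Lemma Ex_distribution (P : probability T R) (U : {mfun T >-> S}) (f : S -> R) :
  bmeas f -> Ex (distribution P U) f = Ex P (fun w => f (U w)).
Proof.
move=> bf; have [mf _] := bf; congr fine; apply: integral_distribution.
  exact/measurable_EFinP.
by apply: bmeas_integrable; exact: bmeas_comp bf.
Qed.

End law.

(** By the independence hypothesis, the law of [(U, V)] agrees on rectangles with the product of [L]
    and the law of [V], hence everywhere; Fubini then integrates [U] out first. *)
Lemma Ex_freeze (R : realType) d d1 d2 (T : measurableType d)
    (S1 : measurableType d1) (S2 : measurableType d2)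
    (P : probability T R) (L : probability S1 R)
    (U : T -> S1) (V : T -> S2) (F : S1 * S2 -> R) :
  measurable_fun setT U -> measurable_fun setT V ->
  (forall A B, measurable A -> measurable B ->
    P (U @^-1` A `&` V @^-1` B) = (L A * P (V @^-1` B))%E) ->
  bmeas F ->
  Ex P (fun w => F (U w, V w)) = Ex P (fun w => Ex L (fun u => F (u, V w))).
Proof.
move=> mU mV indep bF.
have mUV : measurable_fun setT (fun w => (U w, V w)) by exact: measurable_fun_pair.
pose V' : {mfun T >-> S2} := HB.pack V (isMeasurableFun.Build _ _ _ _ V mV).
pose W : {mfun T >-> (S1 * S2)%type} :=
  HB.pack (fun w => (U w, V w)) (isMeasurableFun.Build _ _ _ _ _ mUV).
rewrite -(Ex_distribution P W bF) -(Ex_distribution P V' (bmeas_Ex1 L (distribution P V') bF)).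
rewrite -(Ex_prod2 L (distribution P V') bF); apply: eq_Ex_measure => A mA.
by apply/esym; apply: product_measure_unique mA => B C mB mC; exact: indep.
Qed.

(** * Independence from the rest of a family *)

Section independence.
Context {R : realType} d {T : measurableType d} (P : probability T R).
Context (I : finType) (X : I -> T -> R) (L : I -> probability R R).
Hypothesis mX : forall i, measurable_fun setT (X i).
Hypothesis lawX : forall i A, measurable A -> P (X i @^-1` A) = L i A.
Hypothesis indepX : mutually_independent P X.
Variable a : I.

(** Cylinders that leave coordinate [a] free: an intersection-stable family generating the events
    that depend only on the variables other than [X a]. *)
Definition others : set (set T) :=
  [set B | exists A : I -> set R, [/\ forall i, measurable (A i), A a = setT &
    B = \bigcap_(i in setT) (X i @^-1` A i)]].

Lemma others_preimage i (A : set R) : i != a -> measurable A -> others (X i @^-1` A).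
Proof.
move=> ia mA; exists (fun j => if j == i then A else setT); split.
- by move=> j; case: ifP.
- by rewrite eq_sym (negbTE ia).
- apply/seteqP; split => [w Aw j _|w /(_ i Logic.I)] /=; last by rewrite eqxx.
  by case: eqVneq => // ->.
Qed.

Lemma others_setI : setI_closed others.
Proof.
move=> _ _ [A [mA Aa ->]] [B [mB Ba ->]]; exists (fun i => A i `&` B i); split.
- by move=> i; exact: measurableI.
- by rewrite Aa Ba setTI.
- by rewrite -bigcapI; apply: eq_bigcapr => i _; rewrite preimage_setI.
Qed.

Let mpre i (A : set R) : measurable A -> measurable (X i @^-1` A).
Proof. by move=> mA; rewrite -[X in measurable X]setTI; exact: mX. Qed.

Let pbigcap (A : I -> set R) : (forall i, measurable (A i)) ->
  P (\bigcap_(i in setT) (X i @^-1` A i)) = (\prod_(i : I) P (X i @^-1` A i))%E.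
Proof.
move=> mA; have := @indepX [set: I]%SET A (fun i _ => mA i).
rewrite (_ : [set` [set: I]%SET] = setT); last by apply/seteqP; split => // i _ /=; rewrite inE.
by move=> ->; apply: eq_bigl => i; rewrite inE.
Qed.

Lemma others_measurable B : others B -> measurable B.
Proof.
move=> [A [mA _ ->]]; apply: fin_bigcap_measurable => // i _; exact: mpre.
Qed.

Lemma sigma_others_measurable B : <<s others >> B -> measurable B.
Proof.
apply: smallest_sub; first exact: sigma_algebra_measurable.
exact: others_measurable.
Qed.

(** For fixed [A] both sides are finite measures in [B]. They agree on the cylinders by mutual
    independence, hence on the generated sigma-algebra. *)
Lemma others_indep A B : measurable A -> <<s others >> B ->
  P (X a @^-1` A `&` B) = (L a A * P B)%E.
Proof.
move=> mA sB.
have pA : (0 <= fine (P (X a @^-1` A)))%R by apply: fine_ge0.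
have mXA := mpre a mA.
pose m1 := mrestr P mXA.
pose m2 := mscale (NngNum pA) P.
have m2E C : m2 C = (P (X a @^-1` A) * P C)%E.
  by congr (_ * _)%E; exact/fineK/fin_num_measure.
suff : m1 B = m2 B by rewrite m2E lawX// /m1 /mrestr setIC.
apply: (@g_sigma_algebra_measure_unique _ R T others _ (fun _ => setT)) sB => //.
- exact: others_measurable.
- move=> _; exists (fun _ => setT); split => //.
  by apply/seteqP; split => // w _ i _.
- by apply/seteqP; split => // w _; exists 0%N.
- exact: others_setI.
- move=> _ [C [mC Ca ->]]; apply: etrans (esym (m2E _)); rewrite /m1 /= /mrestr.
  rewrite pbigcap// (bigD1 a)//= Ca preimage_setT probability_setT mul1e.
  (* The cylinder [C] leaves slot [a] free, so [A] can be put there and mutual independence factors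
     the merged cylinder. *)
  pose C' i := if i == a then A else C i.
  rewrite (_ : _ `&` _ = \bigcap_(i in setT) (X i @^-1` C' i)); last first.
    apply/seteqP; split => [w [Cw Aw] i _ /=|w Cw].
      by rewrite /C'; case: eqVneq => [->//|_]; exact: Cw.
    split; last by have := Cw a Logic.I; rewrite /= /C' eqxx.
    move=> i _ /=; have := Cw i Logic.I; rewrite /= /C'; case: eqVneq => // ->.
    by rewrite Ca.
  rewrite pbigcap; last by move=> i; rewrite /C'; case: ifP.
  rewrite (bigD1 a)//= /C' eqxx; congr (_ * _)%E.
  by apply: eq_bigr => i /negbTE ->.
- move=> _; apply: le_lt_trans (ltry 1).
  by apply: probability_le1; exact: measurableI.
Qed.

(* [T] with the sigma-algebra generated by the [X i], [i != a]: a function of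
   all these variables is a measurable function on [othersType], so that
   independence of [X a] from the identity map to [othersType] handles all such
   functions at once, without finite product spaces. *)
Definition othersType := g_sigma_algebraType others.

Lemma measurable_others i : i != a -> measurable_fun setT (X i : othersType -> R).
Proof.
move=> ia _ A mA; rewrite setTI; apply: sub_sigma_algebra; exact: others_preimage.
Qed.

Lemma Ex_others (F : R * othersType -> R) : bmeas F ->
  Ex P (fun w => F (X a w, w)) = Ex P (fun w => Ex (L a) (fun u => F (u, w))).
Proof.
move=> bF; apply: (@Ex_freeze _ _ _ _ T _ othersType P (L a) (X a) id) => //.
  by move=> _ B mB; rewrite setTI; exact: sigma_others_measurable.
by move=> A B mA mB; exact: others_indep.
Qed.

Lemma Ex_mul_indep (g : R -> R) (H : othersType -> R) : bmeas g -> bmeas H ->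
  Ex P (fun w => g (X a w) * H w) = Ex (L a) g * Ex P (H : T -> R).
Proof.
move=> bg bH; rewrite (@Ex_others (fun z => g z.1 * H z.2)) /=; last first.
  by apply: bmeasM; [exact: (bmeas_comp _ bg)|exact: (bmeas_comp _ bH)].
rewrite -ExZ//; last first.
  have [mH bdH] := bH; split => // _ A mA; exact: sigma_others_measurable (mH _ _ mA).
congr Ex; apply/funext => w; rewrite mulrC -ExZ//; congr Ex.
by apply/funext => u; rewrite mulrC.
Qed.

End independence.

(** * Characteristic functions *)

Section trigonometric_bounds.
Context {R : realType}.
Implicit Types x : R.

Let sqr_normr x : `|x| ^+ 2 = x ^+ 2. Proof. exact: real_normK (num_real x). Qed.

Lemma sin_mvt x : 0 <= x -> exists2 c, 0 <= c <= x & sin x = cos c * x.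
Proof.
move=> x0; have [c] : exists2 c, c \in `[0, x]%R & sin x - sin 0 = cos c * (x - 0).
  apply: MVT_segment => //; apply: continuous_subspaceT => y; exact: continuous_sin.
by rewrite in_itv /= sin0 !subr0 => cx E; exists c.
Qed.

Lemma norm_sin_le x : `|sin x| <= `|x|.
Proof.
wlog x0 : x / 0 <= x => [wl|].
  have [/wl//|/ltW x0] := leP 0 x.
  by rewrite -normrN -(normrN x) -sinN wl// oppr_ge0.
have [c _ ->] := sin_mvt x0.
by rewrite normrM ler_piMl// cos_max.
Qed.

Lemma cosE_sin_half x : cos x = 1 - 2 * sin (x / 2) ^+ 2.
Proof.
have {1}-> : x = (x / 2) *+ 2 by rewrite mulr2n -splitr.
by rewrite cos_mulr2n cos2sin2; ring.
Qed.

Lemma cos_ge_quadratic x : 1 - x ^+ 2 / 2 <= cos x.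
Proof.
rewrite cosE_sin_half lerD2l lerN2.
have -> : x ^+ 2 / 2 = 2 * (x / 2) ^+ 2 by field.
by rewrite ler_pM2l// -[leLHS]sqr_normr -[leRHS]sqr_normr lerXn2r// ?nnegrE// norm_sin_le.
Qed.

(** The mean value theorem gives [sin x = cos c * x] with [0 <= c <= x], and [cos c] is at least
    [1 - c^2 / 2]. *)
Lemma sin_ge_cubic x : 0 <= x -> x - x ^+ 3 / 2 <= sin x.
Proof.
move=> x0; have [c /andP[c0 cx] ->] := sin_mvt x0.
have : x - x ^+ 3 / 2 <= (1 - c ^+ 2 / 2) * x.
  have c2 : c ^+ 2 <= x ^+ 2 by rewrite lerXn2r ?nnegrE.
  have -> : x - x ^+ 3 / 2 = (1 - x ^+ 2 / 2) * x by field.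
  by rewrite ler_wpM2r//; lra.
by move=> /le_trans; apply; rewrite ler_wpM2r// cos_ge_quadratic.
Qed.

Lemma norm_sinB_le x : `|x| <= 1 -> `|sin x - x| <= x ^+ 2.
Proof.
wlog x0 : x / 0 <= x => [wl|].
  have [/wl//|/ltW x0] := leP 0 x.
  rewrite -normrN => /wl; rewrite oppr_ge0 sinN sqrrN -normrN opprB addrC opprK.
  by apply.
rewrite ger0_norm// => x1; rewrite ler0_norm.
  have := sin_ge_cubic x0; have : x ^+ 3 <= x ^+ 2 by rewrite exprS ler_piMl ?sqr_ge0.
  have := sqr_ge0 x; lra.
rewrite subr_le0; have := norm_sin_le x; rewrite (ger0_norm x0).
by apply: le_trans; exact: ler_norm.
Qed.

Lemma cos_le_quadratic x : `|x| <= 1 -> cos x <= 1 - x ^+ 2 / 4.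
Proof.
wlog x0 : x / 0 <= x => [wl|].
  have [/wl//|/ltW x0] := leP 0 x.
  by rewrite -normrN => /wl; rewrite oppr_ge0 cosN sqrrN; apply.
rewrite ger0_norm// => x1; rewrite cosE_sin_half.
set y := x / 2.
have y0 : 0 <= y by rewrite /y; lra.
have y1 : y <= 1 / 2 by rewrite /y; lra.
have xE : x = 2 * y by rewrite /y; field.
(* The constant is [1 - (1/2)^2 / 2]. It leaves room at the end: [2 * (7/8)^2 / 4] exceeds [1/4]. *)
have sy : 7 / 8 * y <= sin y.
  apply: le_trans (sin_ge_cubic y0).
  have : y ^+ 2 <= (1 / 2) ^+ 2 by rewrite lerXn2r ?nnegrE//; lra.
  have -> : y - y ^+ 3 / 2 = (1 - y ^+ 2 / 2) * y by field.
  by move=> y2; rewrite ler_wpM2r//; lra.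
have : (7 / 8 * y) ^+ 2 <= sin y ^+ 2 by rewrite lerXn2r ?nnegrE; lra.
have := sqr_ge0 y; rewrite xE !exprMn; lra.
Qed.

End trigonometric_bounds.

(** * Squared modulus of a characteristic function at a low frequency *)

Section characteristic_function.
Context {R : realType}.

Let sqr_normr (x : R) : `|x| ^+ 2 = x ^+ 2. Proof. exact: real_normK (num_real x). Qed.

Lemma bmeas_cos d (T : measurableType d) (g : T -> R) :
  measurable_fun setT g -> bmeas (fun w => cos (g w)).
Proof.
move=> mg; split; last by exists 1 => w; exact: cos_max.
apply: measurableT_comp mg; apply: continuous_measurable_fun; exact: continuous_cos.
Qed.

Lemma bmeas_sin d (T : measurableType d) (g : T -> R) :
  measurable_fun setT g -> bmeas (fun w => sin (g w)).
Proof.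
move=> mg; split; last by exists 1 => w; exact: sin_max.
apply: measurableT_comp mg; apply: continuous_measurable_fun; exact: continuous_sin.
Qed.

(* Squared modulus of the characteristic function of [g] at frequency 1. *)
Definition charsq d (T : measurableType d) (P : probability T R) (g : T -> R) : R :=
  Ex P (fun w => cos (g w)) ^+ 2 + Ex P (fun w => sin (g w)) ^+ 2.

Lemma charsq_ge0 d (T : measurableType d) (P : probability T R) (g : T -> R) :
  0 <= charsq P g.
Proof. by rewrite addr_ge0// sqr_ge0. Qed.

Lemma charsq_le1 d (T : measurableType d) (P : probability T R) (g : T -> R) :
  measurable_fun setT g -> charsq P g <= 1.
Proof.
move=> mg; have bc := bmeas_cos mg; have bs := bmeas_sin mg.
rewrite -[leRHS](Ex_cst P) (_ : (fun=> 1) = fun w => cos (g w) ^+ 2 + sin (g w) ^+ 2); last first.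
  by apply/funext => w; rewrite cos2Dsin2.
by rewrite ExD; [rewrite lerD// sqr_Ex_le|exact: bmeasX..].
Qed.

(** With [y = s^2 * v], the cosine part is at most [1 - y/4]. Centering cancels the linear term of
    the sine, so the sine part is at most [y] in absolute value. The squares add up to
    [1 - y/2 + 17/16 * y^2], which is at most [1 - y/4] since [y <= 4/25]. *)
Lemma charsq_le_variance d (T : measurableType d) (P : probability T R)
    (g : T -> R) (s : R) :
  bmeas g -> (forall x, `|g x| <= 2) -> Ex P g = 0 -> `|s| <= 5^-1 ->
  charsq P (fun x => s * g x) <= 1 - s ^+ 2 * Ex P (fun x => g x ^+ 2) / 4.
Proof.
move=> bg g2 g0 s5; set v := Ex P _.
have bsg : bmeas (fun x => s * g x) by apply: bmeasM => //; exact: bmeas_cst.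
have sg1 x : `|s * g x| <= 1.
  rewrite normrM (le_trans (ler_pM _ _ s5 (g2 x)))//; lra.
have v0 : 0 <= v by apply: Ex_ge0 => x; exact: sqr_ge0.
have v4 : v <= 4.
  apply: Ex_le_cst => [|x]; first exact: bmeasX.
  rewrite (_ : 4 = 2 ^+ 2); last ring.
  by rewrite -sqr_normr lerXn2r ?nnegrE.
have sgv : Ex P (fun x => (s * g x) ^+ 2) = s ^+ 2 * v.
  rewrite -ExZ; last exact: bmeasX.
  by congr Ex; apply/funext => x; rewrite exprMn.
have [msg _] := bsg.
(* Nonnegativity is what allows the upper bound [c1] to be squared below. *)
have c0 : 0 <= Ex P (fun x => cos (s * g x)).
  apply: Ex_ge0 => x; apply: le_trans (cos_ge_quadratic _).
  have : (s * g x) ^+ 2 <= 1 by rewrite -sqr_normr expr_le1.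
  lra.
have c1 : Ex P (fun x => cos (s * g x)) <= 1 - s ^+ 2 * v / 4.
  rewrite -sgv [leRHS](_ : _ = Ex P (fun x => 1 - 4^-1 * (s * g x) ^+ 2)).
    apply: le_Ex; first exact: bmeas_cos.
      apply: bmeasB; first exact: bmeas_cst.
      by apply: bmeasM; [exact: bmeas_cst|exact: bmeasX].
    by move=> x; rewrite [4^-1 * _]mulrC; exact: cos_le_quadratic.
  rewrite ExB ?Ex_cst ?ExZ//; first by rewrite mulrC.
  - exact: bmeasX.
  - exact: bmeas_cst.
  - by apply: bmeasM; [exact: bmeas_cst|exact: bmeasX].
have d1 : `|Ex P (fun x => sin (s * g x))| <= s ^+ 2 * v.
  have -> : Ex P (fun x => sin (s * g x)) = Ex P (fun x => sin (s * g x) - s * g x).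
    by rewrite ExB ?ExZ ?g0 ?mulr0 ?subr0//; exact: bmeas_sin.
  rewrite -sgv; apply: norm_Ex_le => //.
  - by apply: bmeasB => //; exact: bmeas_sin.
  - exact: bmeasX.
  - by move=> x; exact: norm_sinB_le.
rewrite /charsq; set c := Ex P _ in c0 c1 *; set e := Ex P _ in d1 *.
set y := s ^+ 2 * v in c1 d1 *.
have y0 : 0 <= y by rewrite mulr_ge0// sqr_ge0.
have y1 : y <= 4 / 25.
  have : s ^+ 2 <= 5^-1 ^+ 2 by rewrite -sqr_normr lerXn2r ?nnegrE.
  move=> /ler_pM /(_ v4); rewrite sqr_ge0 v0 => /(_ isT isT) /le_trans; apply.
  by rewrite le_eqVlt; apply/orP; left; apply/eqP; field.
have c2 : c ^+ 2 <= (1 - y / 4) ^+ 2 by rewrite lerXn2r ?nnegrE//; lra.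
have e2 : e ^+ 2 <= y ^+ 2 by rewrite -[leLHS]sqr_normr lerXn2r ?nnegrE.
apply: le_trans (lerD c2 e2) _.
have : y * y <= y * (4 / 25) by rewrite ler_wpM2l.
by nra.
Qed.

End characteristic_function.

(** * Sums over independent families: orthogonality and multiplicativity *)

Lemma Ex_sqr_sum_orthogonal (R : realType) d (T : measurableType d)
    (P : probability T R) (K : finType) (Z : K -> T -> R) :
  (forall k, bmeas (Z k)) ->
  (forall k k', k != k' -> Ex P (fun w => Z k w * Z k' w) = 0) ->
  Ex P (fun w => (\sum_k Z k w) ^+ 2) = \sum_k Ex P (fun w => Z k w ^+ 2).
Proof.
move=> bZ orth; rewrite (_ : (fun w => _) =
    fun w => \sum_k \sum_k' Z k w * Z k' w); last first.
  by apply/funext => w; rewrite expr2 big_distrlr.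
rewrite Ex_sum => [|k _]; last by apply: bmeas_sum => k' _; exact: bmeasM.
apply: eq_bigr => k _; rewrite Ex_sum => [|k' _]; last exact: bmeasM.
rewrite (bigD1 k)//= big1 ?addr0 => [|k' k'k]; last by rewrite orth// eq_sym.
by congr Ex; apply/funext => w; rewrite expr2.
Qed.

Section independent_sums.
Context {R : realType} d {T : measurableType d} (P : probability T R).
Context (I : finType) (X : I -> T -> R) (L : I -> probability R R).
Hypothesis mX : forall i, measurable_fun setT (X i).
Hypothesis lawX : forall i A, measurable A -> P (X i @^-1` A) = L i A.
Hypothesis indepX : mutually_independent P X.

Let bmeasX1 i (g : R -> R) : bmeas g -> bmeas (fun w => g (X i w)).
Proof. by move=> bg; exact: bmeas_comp bg. Qed.

Let bmeasX2 i j (F : R * R -> R) : bmeas F -> bmeas (fun w => F (X i w, X j w)).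
Proof. by move=> bF; apply: bmeas_comp bF; exact: measurable_fun_pair. Qed.

Lemma Ex_family_law i (g : R -> R) : bmeas g ->
  Ex P (fun w => g (X i w)) = Ex (L i) g.
Proof.
move=> bg; have := Ex_mul_indep (a := i) mX lawX indepX bg (bmeas_cst 1).
rewrite Ex_cst mulr1 => <-; congr Ex.
by apply/funext => w; rewrite mulr1.
Qed.

(** Only the first factor involves [X i]: with all other variables frozen, integrating [X i] first
    gives 0. *)
Lemma Ex_degenerate1 i j i' j' (F G : R * R -> R) :
  bmeas F -> bmeas G -> (forall y, Ex (L i) (fun x => F (x, y)) = 0) ->
  j != i -> i' != i -> j' != i ->
  Ex P (fun w => F (X i w, X j w) * G (X i' w, X j' w)) = 0.
Proof.
move=> bF bG F0 ji i'i j'i.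
have mo k : k != i -> measurable_fun setT (X k : othersType X i -> R).
  exact: measurable_others.
have bH : bmeas (fun w : othersType X i => G (X i' w, X j' w)).
  by apply: bmeas_comp bG; apply: measurable_fun_pair; exact: mo.
have bF' : bmeas (fun z : R * othersType X i => F (z.1, X j z.2)).
  apply: bmeas_comp bF; apply: measurable_fun_pair; first exact: measurable_fst.
  by apply: measurableT_comp; [exact: mo|exact: measurable_snd].
rewrite (@Ex_others _ _ _ P _ _ L mX lawX indepX i
  (fun z => F (z.1, X j z.2) * G (X i' z.2, X j' z.2))) /=; last first.
  apply: bmeasM => //.
  by apply: (@bmeas_comp _ _ _ _ _ (fun w : othersType X i => G (X i' w, X j' w)) snd).
rewrite -[RHS](Ex_cst P 0); congr Ex; apply/funext => w.
transitivity (Ex (L i) (fun u => G (X i' w, X j' w) * F (u, X j w))).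
  by congr Ex; apply/funext => u; rewrite mulrC.
by rewrite ExZ ?F0 ?mulr0//; exact: bmeas_section1.
Qed.

Lemma Ex_degenerate2 i j i' j' (F G : R * R -> R) :
  bmeas F -> bmeas G -> (forall x, Ex (L j) (fun y => F (x, y)) = 0) ->
  i != j -> i' != j -> j' != j ->
  Ex P (fun w => F (X i w, X j w) * G (X i' w, X j' w)) = 0.
Proof.
move=> bF bG F0 ij i'j j'j.
apply: (@Ex_degenerate1 j i i' j' (fun z => F (z.2, z.1)) G) => //.
by apply: bmeas_comp bF; exact: measurable_swap.
Qed.

Lemma Ex_sqr_sum_centered (K : finType) (e : K -> I) (g : R -> R) :
  injective e -> bmeas g -> (forall k, Ex (L (e k)) g = 0) ->
  Ex P (fun w => (\sum_k g (X (e k) w)) ^+ 2) =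
  \sum_k Ex (L (e k)) (fun x => g x ^+ 2).
Proof.
move=> ie bg g0; rewrite (Ex_sqr_sum_orthogonal (Z := fun k w => g (X (e k) w))).
- by apply: eq_bigr => k _; rewrite -Ex_family_law//; exact: bmeasX.
- by move=> k; exact: bmeasX1.
- move=> k k' kk'.
  rewrite (@Ex_mul_indep _ _ _ P _ _ L mX lawX indepX (e k) g (fun w => g (X (e k') w)))//.
    by rewrite g0 mul0r.
  apply: bmeas_comp bg; apply: measurable_others.
  by rewrite (inj_eq ie) eq_sym.
Qed.

(** Two distinct pairs of indices differ in one coordinate; the variable there occurs in only one of
    the two factors, and [F] has mean 0 in it. The terms are thus orthogonal, and only the squares,
    each at most [B^2], remain. *)
Lemma Ex_sqr_sum_degenerate (K K' : finType) (e : K -> I) (e' : K' -> I)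
    (F : R * R -> R) (B : R) :
  injective e -> injective e' -> (forall k k', e k != e' k') -> bmeas F ->
  (forall z, `|F z| <= B) ->
  (forall k y, Ex (L (e k)) (fun x => F (x, y)) = 0) ->
  (forall k x, Ex (L (e' k)) (fun y => F (x, y)) = 0) ->
  Ex P (fun w => (\sum_k \sum_k' F (X (e k) w, X (e' k') w)) ^+ 2) <=
  (#|K| * #|K'|)%:R * B ^+ 2.
Proof.
move=> ie ie' ee' bF FB F1 F2.
rewrite (_ : (fun w => _) = fun w =>
    (\sum_(k : K * K') F (X (e k.1) w, X (e' k.2) w)) ^+ 2); last first.
  by apply/funext => w; rewrite pair_bigA.
rewrite (Ex_sqr_sum_orthogonal
  (Z := fun (k : K * K') w => F (X (e k.1) w, X (e' k.2) w))).
- rewrite -card_prod mulr_natl -sumr_const.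
  apply: ler_sum => k _; apply: Ex_le_cst => [|w].
    by apply: bmeasX; exact: bmeasX2.
  (* The bound at the arbitrary point [(0, 0)] yields [0 <= B]. *)
  by rewrite -real_normK ?num_real// lerXn2r ?nnegrE// (le_trans _ (FB (0, 0))).
- by move=> k; exact: bmeasX2.
- move=> [k k'] [j j'] /=; rewrite xpair_eqE negb_and => /orP[kj|kj'].
    apply: Ex_degenerate1 => //; first by rewrite eq_sym.
      by rewrite (inj_eq ie) eq_sym.
    by rewrite eq_sym.
  apply: Ex_degenerate2 => //.
  by rewrite (inj_eq ie') eq_sym.
Qed.

(** The addition formulas and independence multiply characteristic functions as complex numbers, and
    squared moduli multiply. Distinctness of the indices makes the sum over the tail a function of
    the variables other than the head one. *)
Lemma charsq_sum (s : seq I) (g : I -> R -> R) : uniq s ->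
  (forall i, measurable_fun setT (g i)) ->
  charsq P (fun w => \sum_(i <- s) g i (X i w)) =
  \prod_(i <- s) charsq (L i) (g i).
Proof.
move=> + mg; elim: s => [_|a s IHs /= /andP[as_ us]].
  rewrite big_nil /charsq (_ : (fun w => cos _) = fun=> 1); last first.
    by apply/funext => w; rewrite big_nil cos0.
  rewrite (_ : (fun w => sin _) = fun=> 0); last first.
    by apply/funext => w; rewrite big_nil sin0.
  by rewrite !Ex_cst; ring.
rewrite big_cons -IHs//; set S := fun w => \sum_(i <- s) g i (X i w).
have mS : measurable_fun setT (S : othersType X a -> R).
  rewrite /S; elim: s as_ {IHs us S} => [_|b s IHs].
    rewrite (_ : (fun w => _) = fun=> 0); first exact: measurable_cst.
    by apply/funext => w; rewrite big_nil.
  rewrite inE negb_or => /andP[ab as_].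
  rewrite (_ : (fun w => _) =
      (fun w : othersType X a => g b (X b w) + \sum_(i <- s) g i (X i w))).
    apply: measurable_funD; last exact: IHs.
    by apply: measurableT_comp => //; apply: measurable_others; rewrite eq_sym.
  by apply/funext => w; rewrite big_cons.
have bc := bmeas_cos (mg a); have bs := bmeas_sin (mg a).
have bC := bmeas_cos mS; have bS := bmeas_sin mS.
have widen (H : T -> R) : bmeas (H : othersType X a -> R) -> bmeas H.
  move=> [mH bH]; split => // _ A mA.
  by apply: (sigma_others_measurable mX (a := a)); exact: mH.
pose ga w := g a (X a w).
have mga : measurable_fun setT ga by exact: measurableT_comp (mg a) (mX a).
have Ec : Ex P (fun w => cos (\sum_(i <- a :: s) g i (X i w))) =
    Ex (L a) (fun x => cos (g a x)) * Ex P (fun w => cos (S w)) -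
    Ex (L a) (fun x => sin (g a x)) * Ex P (fun w => sin (S w)).
  rewrite -(Ex_mul_indep mX lawX indepX bc bC) -(Ex_mul_indep mX lawX indepX bs bS).
  rewrite -ExB; last 2 first.
  - by apply: bmeasM; [exact: bmeas_cos|exact: widen].
  - by apply: bmeasM; [exact: bmeas_sin|exact: widen].
  by congr Ex; apply/funext => w; rewrite big_cons cosD.
have Es : Ex P (fun w => sin (\sum_(i <- a :: s) g i (X i w))) =
    Ex (L a) (fun x => sin (g a x)) * Ex P (fun w => cos (S w)) +
    Ex (L a) (fun x => cos (g a x)) * Ex P (fun w => sin (S w)).
  rewrite -(Ex_mul_indep mX lawX indepX bs bC) -(Ex_mul_indep mX lawX indepX bc bS).
  rewrite -ExD; last 2 first.
  - by apply: bmeasM; [exact: bmeas_sin|exact: widen].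
  - by apply: bmeasM; [exact: bmeas_cos|exact: widen].
  by congr Ex; apply/funext => w; rewrite big_cons sinD.
by rewrite /charsq Ec Es; ring.
Qed.

End independent_sums.

(** * Small ball estimates by averages of cosines *)

Section small_ball.
Context {R : realType}.

(** The square of this average is a nonnegative trigonometric polynomial. Four times it dominates
    the indicator of [|x| <= 1/N], while its expectation involves only values of the characteristic
    function. *)
Definition cosine_mean (N : nat) (x : R) : R :=
  N%:R^-1 * \sum_(j < N) cos (j%:R * x).

Lemma cosine_mean_ge_half (N : nat) (x : R) :
  (0 < N)%N -> N%:R * `|x| <= 1 -> 1 <= 4 * cosine_mean N x ^+ 2.
Proof.
move=> N0 Nx.
suff : 1 / 2 <= cosine_mean N x.
  move=> h; have : (1 / 2) ^+ 2 <= cosine_mean N x ^+ 2.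
    by rewrite lerXn2r ?nnegrE//; lra.
  lra.
have NR : 0 < N%:R :> R by rewrite ltr0n.
rewrite /cosine_mean [leRHS]mulrC ler_pdivlMr//.
rewrite (_ : 1 / 2 * N%:R = \sum_(j < N) (1 / 2 : R)); last first.
  by rewrite sumr_const card_ord mulr_natr.
apply: ler_sum => j _; apply: le_trans (cos_ge_quadratic _).
have : `|j%:R * x| <= 1.
  rewrite normrM ger0_norm// (le_trans _ Nx)// ler_wpM2r// ler_nat.
  exact: ltnW.
rewrite -(expr_le1 (n := 2))// real_normK ?num_real//; lra.
Qed.

(** Expanding the square and linearizing the products, each off-diagonal term is a mean of cosines
    at the frequencies [j - j'] and [j + j'], of absolute value between 1 and [2 * N]. Every row
    then sums to at most [1 + N * N^-1 = 2], and the total is at most [4 / N^2 * (2 * N)]. *)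
Lemma Ex_cosine_mean (d : measure_display) (T : measurableType d)
    (P : probability T R) (h : T -> R) (N : nat) :
  (0 < N)%N -> measurable_fun setT h ->
  (forall r : R, 1 <= `|r| <= (2 * N)%:R ->
    `|Ex P (fun w => cos (r * h w))| <= N%:R^-1) ->
  Ex P (fun w => 4 * cosine_mean N (h w) ^+ 2) <= 8 / N%:R.
Proof.
move=> N0 mh small.
have NR : 0 < N%:R :> R by rewrite ltr0n.
have bcos r : bmeas (fun w => cos (r * h w)).
  by apply: bmeas_cos; apply: measurable_funM => //; exact: measurable_cst.
pose F (j j' : 'I_N) w := cos (j%:R * h w) * cos (j'%:R * h w).
have bF j j' : bmeas (F j j') by exact: bmeasM.
have -> : (fun w => 4 * cosine_mean N (h w) ^+ 2) =
    (fun w => 4 / N%:R ^+ 2 * \sum_j \sum_j' F j j' w).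
  apply/funext => w; rewrite /cosine_mean exprMn exprVn mulrA.
  by rewrite [(\sum_(j < N) _) ^+ 2]expr2 big_distrlr.
rewrite ExZ; last by apply: bmeas_sum => j _; exact: bmeas_sum.
rewrite Ex_sum; last by move=> ? _; exact: bmeas_sum.
have FE (j j' : 'I_N) : Ex P (F j j') = 2^-1 * (Ex P (fun w => cos ((j%:R - j'%:R) * h w))
    + Ex P (fun w => cos ((j%:R + j'%:R) * h w))).
  rewrite -ExD// -ExZ; last exact: bmeasD.
  congr Ex; apply/funext => w; rewrite /F mulrBl mulrDl cosB cosD; lra.
have Fle (j j' : 'I_N) : Ex P (F j j') <= (j == j')%:R + N%:R^-1.
  case: eqVneq => [->|jj'].
    rewrite (le_trans (y := 1)) ?lerDl ?invr_ge0//.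
    apply: Ex_le_cst => // w; rewrite /F -expr2 -real_normK ?num_real//.
    by rewrite expr_le1// cos_max.
  rewrite add0r FE.
  have natdist : 1 <= `|(j%:R : R) - j'%:R|.
    have [jl|jl|/ord_inj e] := ltngtP j j'; last by rewrite e eqxx in jj'.
      by rewrite distrC -(natrB R (ltnW jl)) normr_nat ler1n subn_gt0.
    by rewrite -(natrB R (ltnW jl)) normr_nat ler1n subn_gt0.
  have jN : (j%:R : R) <= N%:R by rewrite ler_nat; exact: ltnW.
  have j'N : (j'%:R : R) <= N%:R by rewrite ler_nat; exact: ltnW.
  have j0 : 0 <= (j%:R : R) by []. have j'0 : 0 <= (j'%:R : R) by [].
  have s1 : `|Ex P (fun w => cos ((j%:R - j'%:R) * h w))| <= N%:R^-1.
    apply: small; rewrite natdist /= natrM.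
    by rewrite (le_trans (ler_normB _ _))// !normr_nat; lra.
  have s2 : `|Ex P (fun w => cos ((j%:R + j'%:R) * h w))| <= N%:R^-1.
    apply: small; apply/andP; split.
      rewrite (le_trans natdist)// (le_trans (ler_normB _ _))// !normr_nat.
      by rewrite ger0_norm// addr_ge0.
    by rewrite natrM ger0_norm ?addr_ge0//; lra.
  move: (le_trans (ler_norm _) s1) (le_trans (ler_norm _) s2); lra.
have sumle : \sum_j Ex P (fun w => \sum_j' F j j' w) <= \sum_(j < N) (2 : R).
  apply: ler_sum => j _; rewrite Ex_sum//.
  apply: (le_trans (ler_sum _ (fun j' _ => Fle j j'))).
  rewrite big_split /= (bigD1 j)//= eqxx big1 ?addr0 => [|j' /negbTE]; last first.
    by rewrite eq_sym => ->.
  by rewrite sumr_const card_ord -[N%:R^-1 *+ N]mulr_natr mulVf ?gt_eqF.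
apply: le_trans (ler_wpM2l _ sumle) _; first by rewrite divr_ge0// sqr_ge0.
rewrite sumr_const card_ord -[2 *+ N]mulr_natr le_eqVlt; apply/orP; left; apply/eqP.
by field; rewrite gt_eqF.
Qed.

End small_ball.

(** * The comparison kernels *)

Section comparison_kernels.
Context {R : realType}.
Implicit Types (M : probability R R) (x y : R) (z : R * R).

Definition gtk z : R := (z.2 < z.1)%R%:R.
Definition ltk z : R := (z.1 < z.2)%R%:R.
Definition eqk z : R := (z.1 == z.2)%:R.
Definition sgk z : R := gtk z - ltk z.

Let bmeas_natb d (T : measurableType d) (b : T -> bool) :
  measurable_fun setT b -> bmeas (fun w => (b w)%:R : R).
Proof.
move=> mb; rewrite (_ : (fun _ => _) = \1_(b @^-1` [set true])).
  by apply: bmeas_indic; rewrite -[X in measurable X]setTI; exact: mb.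
by apply/funext => w; rewrite indicE; congr (_%:R); case E: (b w); [rewrite mem_set|rewrite memNset//= E].
Qed.

Lemma bmeas_gtk : bmeas gtk.
Proof. by apply: bmeas_natb; apply: measurable_fun_ltr. Qed.

Lemma bmeas_ltk : bmeas ltk.
Proof. by apply: bmeas_natb; apply: measurable_fun_ltr. Qed.

Lemma bmeas_eqk : bmeas eqk.
Proof. by apply: bmeas_natb; apply: measurable_fun_eqr. Qed.

Lemma bmeas_sgk : bmeas sgk.
Proof. exact: bmeasB bmeas_gtk bmeas_ltk. Qed.

Definition wins M x := Ex M (fun y => gtk (x, y)).
Definition loses M x := Ex M (fun y => ltk (x, y)).
Definition ties M x := Ex M (fun y => eqk (x, y)).
Definition adv M x := Ex M (fun y => sgk (x, y)).

Lemma bmeas_wins M : bmeas (wins M).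
Proof. exact: (bmeas_Ex2 M M bmeas_gtk). Qed.

Lemma bmeas_loses M : bmeas (loses M).
Proof. exact: (bmeas_Ex2 M M bmeas_ltk). Qed.

Lemma bmeas_ties M : bmeas (ties M).
Proof. exact: (bmeas_Ex2 M M bmeas_eqk). Qed.

Lemma bmeas_adv M : bmeas (adv M).
Proof. exact: (bmeas_Ex2 M M bmeas_sgk). Qed.

Lemma eqk_swap x y : eqk (x, y) = eqk (y, x).
Proof. by rewrite /eqk /= eq_sym. Qed.

Lemma sgk_swap x y : sgk (x, y) = - sgk (y, x).
Proof. by rewrite /sgk /gtk /ltk /= opprB. Qed.

Lemma norm_sgk_le1 z : `|sgk z| <= 1.
Proof.
by rewrite /sgk /gtk /ltk; case: ltgtP; rewrite ?subr0 ?sub0r ?normrN ?normr1 ?normr0.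
Qed.

Lemma kernel_total z : gtk z + ltk z + eqk z = 1.
Proof. by rewrite /gtk /ltk /eqk; case: ltgtP => _; rewrite ?addr0 ?add0r. Qed.

Lemma norm_adv_le1 M x : `|adv M x| <= 1.
Proof.
rewrite -[leRHS](Ex_cst M); apply: norm_Ex_le => [| |y]; last exact: norm_sgk_le1.
  exact: bmeas_section2 bmeas_sgk.
exact: bmeas_cst.
Qed.

Lemma ties_ge0 M x : 0 <= ties M x.
Proof. exact: Ex_ge0. Qed.

Lemma ties_le1 M x : ties M x <= 1.
Proof.
apply: Ex_le_cst => [|y]; first exact: bmeas_section2 bmeas_eqk.
by rewrite /eqk; case: eqP.
Qed.

Lemma wins_ge0 M x : 0 <= wins M x.
Proof. exact: Ex_ge0. Qed.

Lemma wins_loses_ties M x : wins M x + loses M x + ties M x = 1.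
Proof.
rewrite -[RHS](Ex_cst M) /wins /loses /ties -!ExD.
- by congr Ex; apply/funext => y; exact: kernel_total.
- by apply: bmeasD; apply: bmeas_section2; [exact: bmeas_gtk|exact: bmeas_ltk].
- exact: bmeas_section2 bmeas_eqk.
- exact: bmeas_section2 bmeas_gtk.
- exact: bmeas_section2 bmeas_ltk.
Qed.

Lemma wins_le1 M x : wins M x <= 1.
Proof.
rewrite -(wins_loses_ties M x) -addrA lerDl addr_ge0 ?ties_ge0//.
exact: Ex_ge0.
Qed.

Lemma adv_wins M x : adv M x = wins M x - loses M x.
Proof. by rewrite /adv ExB//; apply: bmeas_section2; [exact: bmeas_gtk|exact: bmeas_ltk]. Qed.

Lemma Ex_swap M M' (F : R * R -> R) : bmeas F ->
  Ex M (fun x => Ex M' (fun y => F (x, y))) =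
  Ex M' (fun y => Ex M (fun x => F (x, y))).
Proof. by move=> bF; rewrite -Ex_prod1// Ex_prod2. Qed.

(** Antisymmetry of [sgk] and Fubini. Both one-variable projections of [sgk] can therefore be
    centered by the same constant. *)
Lemma Ex_adv_swap M M' : Ex M' (adv M) = - Ex M (adv M').
Proof.
rewrite /adv Ex_swap; last exact: bmeas_sgk.
rewrite -ExN; last exact: bmeas_adv.
congr Ex; apply/funext => x; rewrite -ExN; last exact: bmeas_section2 bmeas_sgk.
by congr Ex; apply/funext => y; exact: sgk_swap.
Qed.

Lemma Ex_ties_swap M M' : Ex M' (ties M) = Ex M (ties M').
Proof.
rewrite /ties Ex_swap; last exact: bmeas_eqk.
by congr Ex; apply/funext => x; congr Ex; apply/funext => y; exact: eqk_swap.
Qed.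

Lemma Ex_loses_wins M M' : Ex M' (loses M) = Ex M (wins M').
Proof. by rewrite /loses Ex_swap; [|exact: bmeas_ltk]. Qed.

(* The completely degenerate part of [sgk] in its Hoeffding decomposition. *)
Definition degk M M' z : R :=
  sgk z - adv M' z.1 + adv M z.2 + Ex M (adv M').

Lemma bmeas_degk M M' : bmeas (degk M M').
Proof.
apply: bmeasD; last exact: bmeas_cst.
apply: bmeasD; last by apply: bmeas_comp (bmeas_adv M); exact: measurable_snd.
apply: bmeasB; first exact: bmeas_sgk.
by apply: bmeas_comp (bmeas_adv M'); exact: measurable_fst.
Qed.

Lemma norm_Ex_adv_le1 M M' : `|Ex M (adv M')| <= 1.
Proof.
rewrite -[leRHS](Ex_cst M); apply: norm_Ex_le => [| |x]; last exact: norm_adv_le1.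
  exact: bmeas_adv.
exact: bmeas_cst.
Qed.

Lemma norm_degk_le M M' z : `|degk M M' z| <= 4.
Proof.
have := norm_sgk_le1 z; have := norm_adv_le1 M' z.1; have := norm_adv_le1 M z.2.
have := norm_Ex_adv_le1 M M'; rewrite /degk !ler_norml; lra.
Qed.

Lemma Ex_degk1 M M' y : Ex M (fun x => degk M M' (x, y)) = 0.
Proof.
have bs := bmeas_section1 y bmeas_sgk; have ba := bmeas_adv M'.
have bsa := bmeasB bs ba; have bsac := bmeasD bsa (bmeas_cst (adv M y)).
rewrite /degk /= (ExD _ bsac (bmeas_cst _)) (ExD _ bsa (bmeas_cst _)) (ExB _ bs ba) !Ex_cst.
have -> : Ex M (fun x => sgk (x, y)) = - adv M y.
  rewrite /adv -ExN; last exact: bmeas_section2 bmeas_sgk.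
  by congr Ex; apply/funext => x; exact: sgk_swap.
by rewrite -/(adv M'); ring.
Qed.

Lemma Ex_degk2 M M' x : Ex M' (fun y => degk M M' (x, y)) = 0.
Proof.
have bs := bmeas_section2 x bmeas_sgk; have ba := bmeas_adv M.
have bsc := bmeasB bs (bmeas_cst (adv M' x)); have bsca := bmeasD bsc ba.
rewrite /degk /= (ExD _ bsca (bmeas_cst _)) (ExD _ bsc ba) (ExB _ bs (bmeas_cst _)) !Ex_cst.
by rewrite -/(adv M' x) (Ex_adv_swap M M'); ring.
Qed.

End comparison_kernels.

(** * The parameters p, q, r, s as moments of one-variable functions *)

Section moments.
Context {R : realType} {l : nat} (L : 'I_l -> probability R R).
Implicit Types (k : 'I_l).

Let fine_Ex d (T : measurableType d) (P : probability T R) (A : set T) (g : T -> R) :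
  bmeas g -> (forall z, g z = \1_A z) -> fine (P A) = Ex P g.
Proof.
move=> [mg _] gA.
have mA : measurable A.
  (* Measurability of the event is read off from its indicator, as the preimage of 1. *)
  rewrite (_ : A = g @^-1` [set 1]).
    by rewrite -[X in measurable X]setTI; apply: mg.
  apply/seteqP; split => z /=; rewrite gA indicE; first by move=> Az; rewrite mem_set.
  by case: (boolP (z \in A)) => [/set_mem//|_ /eqP]; rewrite eq_sym oner_eq0.
by rewrite (funext gA) Ex_indic.
Qed.

Lemma pwinE k : pwin L k = Ex (L k) (wins (L (ordS k))).
Proof.
rewrite /pwin (@fine_Ex _ _ _ _ gtk); [|exact: bmeas_gtk|].
  by rewrite Ex_prod1//; exact: bmeas_gtk.
by move=> z; rewrite /gtk indicE; congr (nat_of_bool _)%:R; apply/idP/idP; rewrite inE.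
Qed.

Lemma ptieE k : ptie L k = Ex (L k) (ties (L (ordS k))).
Proof.
rewrite /ptie (@fine_Ex _ _ _ _ eqk); [|exact: bmeas_eqk|].
  by rewrite Ex_prod1//; exact: bmeas_eqk.
by move=> z; rewrite /eqk indicE; congr (nat_of_bool _)%:R; apply/eqP/idP; rewrite inE.
Qed.

(** Pointwise, [wins - loses = 2 * wins - 1 + ties]. The right-hand side is [-2] times the quantity
    assumed to be [o(m^-1/2)]. *)
Lemma Ex_adv k : Ex (L k) (adv (L (ordS k))) = 2 * pwin L k - 1 + ptie L k.
Proof.
rewrite pwinE ptieE -{2}(Ex_cst (L k) 1) -ExZ; last exact: bmeas_wins.
rewrite -ExB; last 2 first.
- by apply: bmeasM; [exact: bmeas_cst|exact: bmeas_wins].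
- exact: bmeas_cst.
rewrite -ExD; last 2 first.
- by apply: bmeasB; [apply: bmeasM; [exact: bmeas_cst|exact: bmeas_wins]|exact: bmeas_cst].
- exact: bmeas_ties.
congr Ex; apply/funext => x; rewrite adv_wins.
have := wins_loses_ties (L (ordS k)) x; lra.
Qed.

(** Given the face of die [k], the two faces of the next die are independent, so the conditional
    probability is a square. The formulas for [qwin] and [swin] condition likewise on the face
    shared by the two comparisons. *)
Lemma rwinE k : rwin L k = Ex (L k) (fun x => wins (L (ordS k)) x ^+ 2).
Proof.
have b1 : bmeas (fun z : R * R * R => gtk z.1 * gtk (z.1.1, z.2)).
  apply: bmeasM; first exact: bmeas_comp bmeas_gtk.
  apply: bmeas_comp bmeas_gtk; apply: measurable_fun_pair => //.
  exact: measurableT_comp.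
rewrite /rwin (fine_Ex _ b1) => [|z]; last first.
  rewrite indicE /gtk -natrM mulnb; congr (nat_of_bool _)%:R.
  by apply/andP/idP; rewrite inE.
rewrite Ex_prod1//= Ex_prod1; last exact: (bmeas_Ex2 (L k \x L (ordS k))%E _ b1).
congr Ex; apply/funext => x; rewrite /wins /= expr2.
rewrite -ExZ; last exact: bmeas_section2 bmeas_gtk.
congr Ex; apply/funext => y; rewrite mulrC -ExZ//.
exact: bmeas_section2 bmeas_gtk.
Qed.

Lemma qwinE k : qwin L k = Ex (L (ordS k)) (fun y => loses (L k) y ^+ 2).
Proof.
have b1 : bmeas (fun z : R * R * R => gtk (z.1.1, z.2) * gtk (z.1.2, z.2)).
  by apply: bmeasM; apply: bmeas_comp bmeas_gtk; apply: measurable_fun_pair => //;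
    exact: measurableT_comp.
rewrite /qwin (fine_Ex _ b1) => [|z]; last first.
  rewrite indicE /gtk -natrM mulnb; congr (nat_of_bool _)%:R.
  by apply/andP/idP; rewrite inE.
rewrite Ex_prod2//=; congr Ex; apply/funext => y.
rewrite Ex_prod1 /=; last exact: (bmeas_section1 y b1).
rewrite /loses expr2 -ExZ; last exact: bmeas_section2 bmeas_ltk.
congr Ex; apply/funext => x; rewrite mulrC -ExZ//.
exact: bmeas_section2 bmeas_ltk.
Qed.

Lemma swinE k : swin L k =
  Ex (L k) (fun x => loses (L (ord_pred k)) x * wins (L (ordS k)) x).
Proof.
have b1 : bmeas (fun z : R * R * R => gtk z.1 * gtk (z.1.2, z.2)).
  apply: bmeasM; first exact: bmeas_comp bmeas_gtk.
  apply: bmeas_comp bmeas_gtk; apply: measurable_fun_pair => //.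
  exact: measurableT_comp.
rewrite /swin (fine_Ex _ b1) => [|z]; last first.
  rewrite indicE /gtk -natrM mulnb; congr (nat_of_bool _)%:R.
  by apply/andP/idP; rewrite inE.
rewrite Ex_prod1//= Ex_prod2; last first.
  exact: (bmeas_Ex2 (L (ord_pred k) \x L k)%E _ b1).
congr Ex; apply/funext => x; rewrite /wins /= mulrC.
rewrite -ExZ; last exact: bmeas_section2 bmeas_ltk.
congr Ex; apply/funext => y; rewrite mulrC -ExZ//.
exact: bmeas_section2 bmeas_gtk.
Qed.

End moments.

(** * Hoeffding decomposition of the duels *)

(** Cauchy-Schwarz against the constant 1, obtained from [2ab <= a^2 + b^2] on each product. *)
Lemma sqr_sum_le (R : realType) (K : finType) (x : K -> R) :
  (\sum_k x k) ^+ 2 <= #|K|%:R * \sum_k x k ^+ 2.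
Proof.
rewrite expr2 big_distrlr /=.
apply: (@le_trans _ _ (\sum_k \sum_k' (2^-1 * x k ^+ 2 + 2^-1 * x k' ^+ 2))).
  apply: ler_sum => k _; apply: ler_sum => k' _.
  have := sqr_ge0 (x k - x k'); nra.
have -> : \sum_k \sum_k' (2^-1 * x k ^+ 2 + 2^-1 * x k' ^+ 2) =
    \sum_k (#|K|%:R * 2^-1 * x k ^+ 2 + \sum_k' 2^-1 * x k' ^+ 2).
  by apply: eq_bigr => k _; rewrite big_split /= sumr_const -[(_ * _) *+ _]mulr_natl mulrA.
rewrite big_split /= sumr_const -[(\sum_k _) *+ _]mulr_natl -!mulr_sumr -!mulrA -mulrDr.
by rewrite -mulrDl -[2^-1]div1r -splitr mul1r.
Qed.

Section dice.
Context {R : realType} {l : nat} (hl : (3 <= l)%N).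
Context d (T : measurableType d) (P : probability T R).
Context (n : 'I_l -> nat) (L : 'I_l -> probability R R).
Context (D : forall k : 'I_l, 'I_(n k) -> {RV P >-> R}).
Hypothesis hD : independent_random_dice L D.
Hypothesis n0 : forall k, (0 < n k)%N.

Let I : finType := {k : 'I_l & 'I_(n k)}.
Let X (i : I) : T -> R := D (tagged i).
Let LI (i : I) : probability R R := L (tag i).
Let face k (i : 'I_(n k)) : I := Tagged (fun k => 'I_(n k)) i.

Let mX i : measurable_fun setT (X i). Proof. exact: measurable_funP. Qed.

Let lawX i A : measurable A -> P (X i @^-1` A) = LI i A.
Proof. by move=> mA; have [/(_ _ (tagged i) _ mA) <- _] := hD. Qed.

Let indepX : mutually_independent P X. Proof. exact: hD.2. Qed.

Let face_inj k : injective (@face k).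
Proof. by move=> i j /eqP; rewrite -tag_eqE /tag_eq eqxx tagged_asE => /eqP. Qed.

Lemma ordS_neq (k : 'I_l) : ordS k != k.
Proof.
apply/eqP => /(congr1 val) /=; have kl := ltn_ord k.
have [kl'|kl'] := ltnP k.+1 l.
  by rewrite modn_small// => /esym/eqP; rewrite -{1}[val k]addn0 -addn1 eqn_add2l.
have kE : k.+1 = l by apply/eqP; rewrite eqn_leq kl kl'.
by rewrite kE modnn => k0; move: hl; rewrite -kE -k0.
Qed.

Let face_neq k i j : @face k i != @face (ordS k) j.
Proof.
apply/eqP => e; have ke : k = ordS k := congr1 tag e.
by have := ordS_neq k; rewrite -ke eqxx.
Qed.

Definition edge k : R := Ex (L k) (adv (L (ordS k))).

Definition duel k w : R :=
  ((n k)%:R * (n (ordS k))%:R)^-1 *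
  \sum_i \sum_j sgk (@D k i w, @D (ordS k) j w).

(** [front] and [back] are the first-order Hoeffding projections of [duel k]: the centered
    contributions of one face of die [k] and of one face of its opponent. *)
Definition front k x : R := adv (L (ordS k)) x - edge k.
Definition back k x : R := - adv (L k) x - edge k.

Definition linear_part k w : R :=
  (n k)%:R^-1 * (\sum_i front k (@D k i w)) +
  (n (ordS k))%:R^-1 * (\sum_j back k (@D (ordS k) j w)).

Definition residue k w : R :=
  ((n k)%:R * (n (ordS k))%:R)^-1 *
  \sum_i \sum_j degk (L k) (L (ordS k)) (@D k i w, @D (ordS k) j w).

Let nR0 k : (n k)%:R != 0 :> R. Proof. by rewrite pnatr_eq0 -lt0n. Qed.

Lemma duelE k w : duel k w = edge k + linear_part k w + residue k w.
Proof.
rewrite /duel /linear_part /residue.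
(* The definition of [degk], solved for [sgk] and summed over all pairs of faces. *)
have -> : \sum_i \sum_j sgk (@D k i w, @D (ordS k) j w) =
   \sum_i \sum_j degk (L k) (L (ordS k)) (@D k i w, @D (ordS k) j w) +
   (n (ordS k))%:R * (\sum_i adv (L (ordS k)) (@D k i w)) -
   (n k)%:R * (\sum_j adv (L k) (@D (ordS k) j w)) -
   (n k)%:R * (n (ordS k))%:R * edge k.
  have -> : (n (ordS k))%:R * (\sum_i adv (L (ordS k)) (@D k i w)) =
      \sum_i \sum_(j < n (ordS k)) adv (L (ordS k)) (@D k i w).
    by rewrite mulr_sumr; apply: eq_bigr => i _; rewrite sumr_const card_ord mulr_natl.
  have -> : (n k)%:R * (\sum_j adv (L k) (@D (ordS k) j w)) =
      \sum_(i < n k) \sum_j adv (L k) (@D (ordS k) j w).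
    by rewrite sumr_const card_ord mulr_natl.
  have -> : (n k)%:R * (n (ordS k))%:R * edge k =
      \sum_(i < n k) \sum_(j < n (ordS k)) edge k.
    by rewrite !sumr_const !card_ord -mulrA !mulr_natl.
  rewrite -big_split -!sumrB; apply: eq_bigr => i _ /=.
  rewrite -big_split -!sumrB; apply: eq_bigr => j _ /=.
  rewrite /degk /edge /=; ring.
rewrite /front /back !sumrB sumrN !sumr_const !card_ord.
rewrite -[edge k *+ n k]mulr_natl -[edge k *+ n (ordS k)]mulr_natl.
by field; rewrite !nR0.
Qed.

Let bmeas_front k : bmeas (front k).
Proof. by apply: bmeasB; [exact: bmeas_adv|exact: bmeas_cst]. Qed.

Let bmeas_back k : bmeas (back k).
Proof. by apply: bmeasB; [apply: bmeasN; exact: bmeas_adv|exact: bmeas_cst]. Qed.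

Lemma Ex_front k : Ex (L k) (front k) = 0.
Proof. by rewrite ExB ?Ex_cst ?subrr//; [exact: bmeas_adv|exact: bmeas_cst]. Qed.

Lemma Ex_back k : Ex (L (ordS k)) (back k) = 0.
Proof.
have ba := bmeas_adv (L k).
by rewrite (ExB _ (bmeasN ba) (bmeas_cst _)) ExN// Ex_cst Ex_adv_swap opprK subrr.
Qed.

Let bmeas_face k i (g : R -> R) : bmeas g -> bmeas (fun w => g (@D k i w)).
Proof. by move=> bg; apply: bmeas_comp bg; exact: measurable_funP. Qed.

Lemma bmeas_linear_part k : bmeas (linear_part k).
Proof.
apply: bmeasD; apply: bmeasM; rewrite ?bmeas_cst//; try exact: bmeas_cst.
  by apply: bmeas_sum => i _; exact: bmeas_face.
by apply: bmeas_sum => i _; exact: bmeas_face.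
Qed.

Lemma bmeas_residue k : bmeas (residue k).
Proof.
apply: bmeasM; first exact: bmeas_cst.
apply: bmeas_sum => i _; apply: bmeas_sum => j _.
by apply: bmeas_comp (bmeas_degk _ _); apply: measurable_fun_pair; exact: measurable_funP.
Qed.

Lemma bmeas_duel k : bmeas (duel k).
Proof.
apply: bmeasM; first exact: bmeas_cst.
apply: bmeas_sum => i _; apply: bmeas_sum => j _.
by apply: bmeas_comp bmeas_sgk; apply: measurable_fun_pair; exact: measurable_funP.
Qed.

(** The [n k * n (ordS k)] kernel values are orthogonal and bounded by 4, and the normalization
    divides by the square of their number. *)
Lemma Ex_sqr_residue k :
  Ex P (fun w => residue k w ^+ 2) <= 16 / ((n k)%:R * (n (ordS k))%:R).
Proof.
set c := (n k)%:R * _.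
have c0 : 0 < c by rewrite mulr_gt0 ?ltr0n.
pose G w := \sum_i \sum_j degk (L k) (L (ordS k)) (@D k i w, @D (ordS k) j w).
have bG : bmeas G.
  apply: bmeas_sum => i _; apply: bmeas_sum => j _.
  by apply: bmeas_comp (bmeas_degk _ _); apply: measurable_fun_pair; exact: measurable_funP.
have -> : Ex P (fun w => residue k w ^+ 2) = c ^- 2 * Ex P (fun w => G w ^+ 2).
  rewrite -ExZ; last exact: bmeasX.
  by congr Ex; apply/funext => w; rewrite /residue exprMn exprVn.
have : Ex P (fun w => G w ^+ 2) <= c * 4 ^+ 2.
  rewrite /c -natrM -[n k in leRHS]card_ord -[n (ordS k) in leRHS]card_ord.
  apply: (@Ex_sqr_sum_degenerate _ _ _ P _ X LI mX lawX indepX _ _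
    (@face k) (@face (ordS k)) (degk (L k) (L (ordS k)))) => //.
  - exact: face_inj.
  - exact: face_inj.
  - exact: bmeas_degk.
  - exact: norm_degk_le.
  - by move=> i y; exact: Ex_degk1.
  - by move=> j x; exact: Ex_degk2.
move=> /(ler_wpM2l (_ : 0 <= c ^- 2)) /le_trans; apply.
  by rewrite invr_ge0 exprn_ge0// ltW.
by rewrite le_eqVlt; apply/orP; left; apply/eqP; field; rewrite gt_eqF.
Qed.

(** What a face of die [k] contributes to the cyclic sum: once against die [k+1], once as opponent
    of die [k-1]. It equals [adv (L (ordS k)) - adv (L (ord_pred k))] up to a constant. *)
Definition bias k x : R := front k x + back (ord_pred k) x.

Definition spread k : R :=
  Ex (L k) (fun x => (adv (L (ordS k)) x - adv (L (ord_pred k)) x) ^+ 2).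

Definition bias_mean k w : R := (n k)%:R^-1 * \sum_i bias k (@D k i w).

Lemma sum_duel w :
  \sum_k duel k w = \sum_k (edge k + bias_mean k w + residue k w).
Proof.
under eq_bigr do rewrite duelE.
rewrite !big_split /=; congr (_ + _ + _).
pose B k' k := (n k)%:R^-1 * \sum_j back k' (@D k j w).
have -> : \sum_k (n (ordS k))%:R^-1 * (\sum_j back k (@D (ordS k) j w)) =
    \sum_k B (ord_pred k) k.
  (* The cyclic shift regroups each [back] term with the die whose faces it involves. *)
  rewrite [RHS](reindex_inj (@ordS_inj l)).
  by apply: eq_bigr => k _; rewrite ordSK.
rewrite -big_split; apply: eq_bigr => k _ /=.
by rewrite /B /bias_mean -mulrDr -big_split.
Qed.

Let bmeas_bias k : bmeas (bias k). Proof. exact: bmeasD. Qed.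

Lemma Ex_bias k : Ex (L k) (bias k) = 0.
Proof.
rewrite ExD// Ex_front add0r -[in L k](ord_predK k).
exact: Ex_back.
Qed.

(** [bias k] is the difference of advantages minus its mean, and a variance is at most the second
    moment. *)
Lemma Ex_sqr_bias_le k : Ex (L k) (fun x => bias k x ^+ 2) <= spread k.
Proof.
pose g x := adv (L (ordS k)) x - adv (L (ord_pred k)) x.
have bg : bmeas g by apply: bmeasB; exact: bmeas_adv.
have gE x : bias k x = g x - (edge k + edge (ord_pred k)).
  by rewrite /bias /front /back /g; ring.
have Eg : Ex (L k) g = edge k + edge (ord_pred k).
  apply/eqP; rewrite -subr_eq0 -(Ex_bias k) (funext gE).
  by rewrite (ExB _ bg (bmeas_cst _)) Ex_cst.
rewrite (_ : (fun x => bias k x ^+ 2) = fun x => (g x - Ex (L k) g) ^+ 2).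
  by rewrite Ex_sqr_centered// lerBlDr lerDl sqr_ge0.
by apply/funext => x; rewrite gE Eg.
Qed.

Lemma Ex_sqr_bias_mean k :
  Ex P (fun w => bias_mean k w ^+ 2) <= spread k / (n k)%:R.
Proof.
pose G w := \sum_i bias k (@D k i w).
have bG : bmeas G by apply: bmeas_sum => i _; exact: bmeas_face.
have -> : Ex P (fun w => bias_mean k w ^+ 2) = (n k)%:R ^- 2 * Ex P (fun w => G w ^+ 2).
  rewrite -ExZ; last exact: bmeasX.
  by congr Ex; apply/funext => w; rewrite /bias_mean exprMn exprVn.
have -> : Ex P (fun w => G w ^+ 2) = (n k)%:R * Ex (L k) (fun x => bias k x ^+ 2).
  rewrite /G (@Ex_sqr_sum_centered _ _ _ P _ X LI mX lawX indepX _ (@face k)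
    (bias k) (@face_inj k) (bmeas_bias k) (fun=> Ex_bias k)).
  by rewrite /LI /= sumr_const card_ord mulr_natl.
rewrite mulrA (_ : (n k)%:R ^- 2 * (n k)%:R = (n k)%:R^-1); last by field.
by rewrite mulrC ler_wpM2r ?invr_ge0// Ex_sqr_bias_le.
Qed.

(** Cauchy-Schwarz over the [l] duels, then [(x + y + z)^2 <= 3 * (x^2 + y^2 + z^2)] for the mean,
    linear and degenerate parts. *)
Lemma Ex_sqr_sum_duel :
  Ex P (fun w => (\sum_k duel k w) ^+ 2) <=
  l%:R * \sum_k 3 * (edge k ^+ 2 + spread k / (n k)%:R +
    16 / ((n k)%:R * (n (ordS k))%:R)).
Proof.
have bb k : bmeas (bias_mean k).
  by apply: bmeasM; [exact: bmeas_cst|apply: bmeas_sum => i _; exact: bmeas_face].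
pose q k w := 3 * (edge k ^+ 2 + bias_mean k w ^+ 2 + residue k w ^+ 2).
have b3 k : bmeas (fun w => edge k ^+ 2 + bias_mean k w ^+ 2).
  by apply: bmeasD; [exact: bmeas_cst|exact: bmeasX].
have b4 k : bmeas (fun w => edge k ^+ 2 + bias_mean k w ^+ 2 + residue k w ^+ 2).
  by apply: bmeasD => //; apply: bmeasX; exact: bmeas_residue.
have bq k : bmeas (q k) by apply: bmeasM => //; exact: bmeas_cst.
apply: (@le_trans _ _ (Ex P (fun w => l%:R * \sum_k q k w))).
  apply: le_Ex.
  - by apply: bmeasX; apply: bmeas_sum => k _; exact: bmeas_duel.
  - by apply: bmeasM; [exact: bmeas_cst|exact: bmeas_sum].
  move=> w; rewrite sum_duel (le_trans (sqr_sum_le _))// card_ord.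
  rewrite ler_wpM2l// ler_sum// => k _; rewrite /q.
  set x := edge k; set y := bias_mean k w; set z := residue k w.
  have := sqr_ge0 (x - y); have := sqr_ge0 (x - z); have := sqr_ge0 (y - z); nra.
rewrite ExZ; last exact: bmeas_sum.
rewrite Ex_sum// ler_wpM2l// ler_sum// => k _.
rewrite /q ExZ// ler_wpM2l// ExD//; last by apply: bmeasX; exact: bmeas_residue.
rewrite ExD; [|exact: bmeas_cst|exact: bmeasX].
by rewrite Ex_cst lerD ?lerD2l ?Ex_sqr_bias_mean// Ex_sqr_residue.
Qed.

Definition variance k : R := Ex (L k) (fun x => front k x ^+ 2).

(** The squared modulus factors over the faces of both dice. Each face of die [k] gives at most
    [1 - u <= exp (- u)], and [exp (- n u) <= 1 / (1 + n u)]. *)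
Lemma charsq_linear_part k (t : R) : `|t / (n k)%:R| <= 5^-1 ->
  charsq P (fun w => t * linear_part k w) <=
  (1 + t ^+ 2 * variance k / (4 * (n k)%:R))^-1.
Proof.
move=> tn.
pose s := map (@face k) (index_enum _) ++ map (@face (ordS k)) (index_enum _).
have us : uniq s.
  rewrite cat_uniq (map_inj_uniq (@face_inj _)) (map_inj_uniq (@face_inj _)).
  rewrite !index_enum_uniq andbT /=.
  apply/hasPn => _ /mapP[j _ ->]; apply/mapP => -[i _ e].
  by have := face_neq i j; rewrite e eqxx.
pose g (i : I) x := if tag i == k then t / (n k)%:R * front k x
  else t / (n (ordS k))%:R * back k x.
have mg i : measurable_fun setT (g i).
  rewrite /g; case: (tag i == k).
    by have [] := bmeasM (bmeas_cst (t / (n k)%:R)) (bmeas_front k).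
  by have [] := bmeasM (bmeas_cst (t / (n (ordS k))%:R)) (bmeas_back k).
have -> : (fun w => t * linear_part k w) = (fun w => \sum_(i <- s) g i (X i w)).
  apply/funext => w; rewrite /s big_cat !big_map /linear_part mulrDr.
  rewrite /g /= eqxx (negbTE (ordS_neq k)) !mulrA.
  by congr (_ + _); rewrite mulr_sumr.
rewrite (@charsq_sum _ _ _ P _ X LI mX lawX indepX)// /s big_cat !big_map /=.
have q0 i : 0 <= charsq (LI i) (g i) by exact: charsq_ge0.
have q1 i : charsq (LI i) (g i) <= 1 by exact: charsq_le1.
(* The factors from the faces of the opponent are bounded by 1. *)
apply: (@le_trans _ _ (\prod_(i < n k) charsq (LI (face i)) (g (face i)))).
  apply: ler_piMr; first by apply: prodr_ge0 => i _; exact: q0.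
  by apply: prodr_ile1 => j _; rewrite q0 q1.
set u := (t / (n k)%:R) ^+ 2 * variance k / 4.
have v0 : 0 <= variance k by apply: Ex_ge0 => x; exact: sqr_ge0.
have u0 : 0 <= u by rewrite divr_ge0// mulr_ge0// sqr_ge0.
apply: (@le_trans _ _ (\prod_(i < n k) expR (- u))).
  apply: ler_prod => i _; rewrite charsq_ge0 /=.
  apply: le_trans (expR_ge1Dx _).
  rewrite /LI /g /= eqxx; apply: charsq_le_variance => //; last exact: Ex_front.
  move=> x; rewrite (le_trans (ler_normB _ _))//.
  by rewrite (_ : 2 = 1 + 1)// lerD ?norm_adv_le1// norm_Ex_adv_le1.
rewrite prodr_const card_ord -expRM_natl mulrN expRN.
have -> : t ^+ 2 * variance k / (4 * (n k)%:R) = (n k)%:R * u.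
  by rewrite /u; field.
by rewrite lef_pV2 ?posrE ?expR_gt0 ?expR_ge1Dx// ltr_pwDl// mulr_ge0.
Qed.

End dice.

(** * The event that every die beats the next one *)

Lemma die_beatsE (R : realType) (a b : nat) (A : 'I_a -> R) (B : 'I_b -> R) :
  die_beats A B = (0 < \sum_i \sum_j sgk (A i, B j)).
Proof.
rewrite pair_bigA /=.
have card_sum (p : pred ('I_a * 'I_b)) : #|p|%:R = \sum_ij (p ij)%:R :> R.
  by rewrite -sum1_card natr_sum big_mkcond; apply: eq_bigr => ij _; rewrite unfold_in; case: (p ij).
rewrite /sgk sumrB subr_gt0 -!card_sum ltr_nat /die_beats.
by congr (_ < _)%N; apply: eq_card => -[i j]; rewrite !inE.
Qed.

Section all_beat.
Context {R : realType} {l : nat} (hl : (3 <= l)%N).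
Context d (T : measurableType d) (P : probability T R).
Context (n : 'I_l -> nat) (L : 'I_l -> probability R R).
Context (D : forall k : 'I_l, 'I_(n k) -> {RV P >-> R}).
Hypothesis hD : independent_random_dice L D.
Hypothesis n0 : forall k, (0 < n k)%N.

Let event : set T := [set w | forall k : 'I_l,
  die_beats (fun i => @D k i w) (fun j => @D (ordS k) j w)].

Lemma all_beat_duel w : event w <-> forall k, 0 < duel D k w.
Proof.
have c0 k : 0 < ((n k)%:R * (n (ordS k))%:R)^-1 :> R.
  by rewrite invr_gt0 mulr_gt0 ?ltr0n.
split => [ev k|ev k]; last by rewrite die_beatsE -(pmulr_rgt0 _ (c0 k)); exact: ev.
by have := ev k; rewrite die_beatsE -(pmulr_rgt0 _ (c0 k)).
Qed.

Lemma measurable_all_beat : measurable event.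
Proof.
have -> : event = \bigcap_(k in setT) (duel D k @^-1` `]0, +oo[%classic).
  apply/seteqP; split => w; rewrite all_beat_duel.
    by move=> ev k _ /=; rewrite in_itv /= ev.
  by move=> ev k; have := ev k Logic.I; rewrite /= in_itv /= andbT.
apply: fin_bigcap_measurable => // k _; rewrite -[X in measurable X]setTI.
by have [+ _] := bmeas_duel D k; apply.
Qed.

(* Small ball estimate at frequency [4 N sqrt m]: there the characteristic
   function of the linear part is at most [1/N] and the interval has half-length
   [1 / (4 N^2 sqrt m)], a third of which, [1 / (12 N^2 sqrt m)], is allotted to
   each of the sum of the duels, the mean and the residue. *)
Lemma all_beat_le (k : 'I_l) (N : nat) (m : R) :
  (0 < N)%N -> 0 < m -> (n k)%:R <= m ->
  8 * N%:R ^+ 2 * Num.sqrt m / (n k)%:R <= 5^-1 ->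
  4^-1 <= variance L k ->
  12 * N%:R ^+ 2 * Num.sqrt m * `|edge L k| <= 1 ->
  fine (P event) <=
    (12 * N%:R ^+ 2) ^+ 2 * m * Ex P (fun w => (\sum_k duel D k w) ^+ 2) +
    (12 * N%:R ^+ 2) ^+ 2 * m * Ex P (fun w => residue L D k w ^+ 2) +
    8 / N%:R.
Proof.
move=> N0 m0 nm freq var mean.
have NR : 1 <= N%:R :> R by rewrite ler1n.
set q := Num.sqrt m in freq mean.
have q0 : 0 < q by rewrite sqrtr_gt0.
have qq : q ^+ 2 = m by rewrite sqr_sqrtr// ltW.
set e := 12 * N%:R ^+ 2 in mean *.
have N2 : 0 < N%:R ^+ 2 :> R by rewrite exprn_gt0// ltr0n.
have e0 : 0 < e by rewrite mulr_gt0.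
pose h w := 4 * N%:R * q * linear_part L D k w.
have bl := bmeas_linear_part L D k.
have bh : bmeas h by apply: bmeasM => //; exact: bmeas_cst.
have [mh _] := bh.
pose S w := \sum_k duel D k w.
have bS : bmeas S by apply: bmeas_sum => j _; exact: bmeas_duel.
have br := bmeas_residue L D k.
have nk : 0 < (n k)%:R :> R by rewrite ltr0n.
have cosb : Ex P (fun w => 4 * cosine_mean N (h w) ^+ 2) <= 8 / N%:R.
  apply: Ex_cosine_mean => // r /andP[r1 rN].
  pose t := r * (4 * N%:R * q).
  have -> : (fun w => cos (r * h w)) = (fun w => cos (t * linear_part L D k w)).
    by apply/funext => w; rewrite /h /t !mulrA.
  (* With [|r| <= 2 * N], the frequency [t] is at most [8 * N^2 * q], the quantity controlled by
     [freq]. *)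
  have tn : `|t / (n k)%:R| <= 5^-1.
    apply: le_trans freq; rewrite normrM normfV normr_nat; apply: ler_wpM2r; first by rewrite invr_ge0.
    rewrite /t normrM (ger0_norm (_ : 0 <= 4 * _ * q)); last first.
      by rewrite !mulr_ge0 ?ltW//; lra.
    rewrite natrM in rN.
    have -> : 8 * N%:R ^+ 2 * q = 2 * N%:R * (4 * N%:R * q) by ring.
    by rewrite ler_wpM2r// !mulr_ge0 ?ltW//; lra.
  have := charsq_linear_part hl hD n0 tn.
  set v := variance L k in var *; set c := Ex P _ => cq.
  have c2 : c ^+ 2 <= (1 + t ^+ 2 * v / (4 * (n k)%:R))^-1.
    by apply: le_trans cq; rewrite /charsq lerDl sqr_ge0.
  (* Since [|r| >= 1], [t^2] is at least [16 * N^2 * m]; the variance bound [1/4] and [n k <= m]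
     absorb the factor 16 and the denominator. *)
  have big : N%:R ^+ 2 <= 1 + t ^+ 2 * v / (4 * (n k)%:R).
    apply: (@le_trans _ _ (t ^+ 2 * v / (4 * (n k)%:R))); last by rewrite lerDr.
    rewrite ler_pdivlMr; last by rewrite mulr_gt0.
    have tt : 16 * N%:R ^+ 2 * m <= t ^+ 2.
      rewrite /t exprMn -qq; have -> : (4 * N%:R * q) ^+ 2 = 16 * N%:R ^+ 2 * q ^+ 2 by ring.
      rewrite ler_peMl//; first by rewrite mulr_ge0 ?sqr_ge0 ?mulr_ge0 ?sqr_ge0.
      by rewrite -real_normK ?num_real// exprn_ege1.
    have : 16 * N%:R ^+ 2 * m * 4^-1 <= t ^+ 2 * v.
      by apply: ler_pM => //; rewrite ?mulr_ge0 ?sqr_ge0// ltW.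
    apply: le_trans; have : N%:R ^+ 2 * (n k)%:R <= N%:R ^+ 2 * m.
      by rewrite ler_wpM2l// ltW.
    lra.
  rewrite -(ler_pXn2r (n := 2)) ?nnegrE ?invr_ge0//.
  rewrite real_normK ?num_real//; apply: le_trans c2 _.
  by rewrite exprVn lef_pV2// posrE (lt_le_trans N2).
rewrite -Ex_indic; last exact: measurable_all_beat.
have bS2 := bmeasM (bmeas_cst (e ^+ 2 * m)) (bmeasX 2 bS).
have br2 := bmeasM (bmeas_cst (e ^+ 2 * m)) (bmeasX 2 br).
have bc : bmeas (fun w => 4 * cosine_mean N (h w) ^+ 2).
  apply: bmeasM; first exact: bmeas_cst.
  apply: bmeasX; apply: bmeasM; first exact: bmeas_cst.
  apply: bmeas_sum => j _; apply: bmeas_cos.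
  by apply: measurable_funM => //; exact: measurable_cst.
apply: le_trans (lerD (lexx _) cosb).
rewrite -ExZ; last exact: bmeasX.
rewrite -ExZ; last exact: bmeasX.
rewrite -(ExD _ bS2 br2) -(ExD _ (bmeasD bS2 br2) bc).
apply: le_Ex; first exact: bmeas_indic measurable_all_beat.
  exact: bmeasD (bmeasD bS2 br2) bc.
(* Pointwise on the event, either the sum of the duels is large and [s1 >= 1], or the residue is
   large and [s2 >= 1], or the linear part lies in the small ball and [s3 >= 1]. *)
move=> w; rewrite indicE.
set s1 := e ^+ 2 * m * _; set s2 := e ^+ 2 * m * _; set s3 := 4 * _.
have s10 : 0 <= s1 by rewrite mulr_ge0 ?sqr_ge0// mulr_ge0 ?sqr_ge0// ltW.
have s20 : 0 <= s2 by rewrite mulr_ge0 ?sqr_ge0// mulr_ge0 ?sqr_ge0// ltW.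
have s30 : 0 <= s3 by rewrite mulr_ge0// sqr_ge0.
case: (boolP (w \in _)) => [/set_mem/all_beat_duel ev|_] /=; last by rewrite !addr_ge0.
(* All duels are positive, so each one is at most their sum. *)
have dk : duel D k w <= S w.
  by rewrite /S (bigD1 k)//= lerDl sumr_ge0// => j _; exact: ltW.
have d0 := ev k.
have dE := duelE L D n0 k w.
have bigE (x : R) : 1 < e * q * `|x| -> 1 <= e ^+ 2 * m * x ^+ 2.
  move=> ex; have -> : e ^+ 2 * m * x ^+ 2 = (e * q * `|x|) ^+ 2.
    by rewrite -qq -[x ^+ 2]real_normK ?num_real//; ring.
  by rewrite exprn_ege1// ltW.
have [/bigE s11|sS] := ltP 1 (e * q * `|S w|).
  by move: s11; rewrite -/s1; lra.
have [/bigE s21|sr] := ltP 1 (e * q * `|residue L D k w|).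
  by move: s21; rewrite -/s2; lra.
suff : 1 <= s3 by lra.
apply: cosine_mean_ge_half => //.
rewrite /h normrM (ger0_norm (_ : 0 <= 4 * _ * q)); last first.
  by rewrite !mulr_ge0 ?ltW//; lra.
have zle : `|linear_part L D k w| <= `|S w| + `|edge L k| + `|residue L D k w|.
  have -> : linear_part L D k w = duel D k w - edge L k - residue L D k w.
    by rewrite dE; ring.
  rewrite (le_trans (ler_normB _ _))// lerD2r (le_trans (ler_normB _ _))// lerD2r.
  by rewrite (ger0_norm (ltW d0)) (le_trans dk)// ler_norm.
have : e * q * `|linear_part L D k w| <= 3.
  have eq0 : 0 <= e * q by rewrite mulr_ge0 ?ltW.
  by have := ler_wpM2l eq0 zle; rewrite !mulrDr; lra.
have -> : N%:R * (4 * N%:R * q * `|linear_part L D k w|) =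
  (e * q * `|linear_part L D k w|) / 3 by rewrite /e; field.
lra.
Qed.

End all_beat.

(** * Asymptotics *)

Section moment_bounds.
Context {R : realType} {l : nat} (L : 'I_l -> probability R R).
Implicit Types (k : 'I_l).

Lemma edgeE k : edge L k = 2 * pwin L k - 1 + ptie L k.
Proof. exact: Ex_adv. Qed.

Lemma spread_ge0 k : 0 <= spread L k.
Proof. by apply: Ex_ge0 => x; exact: sqr_ge0. Qed.

(** With [V = 2A + 2B - 2], the difference of the advantages is [V + U + U'], where the tie
    probabilities satisfy [U^2 <= U] and [U'^2 <= U']. The right-hand side is three times the mean
    of [V^2 + U + U']. *)
Lemma spread_le k : spread L k <=
  3 * (4 * rwin L k + 4 * qwin L (ord_pred k) + 8 * swin L k + 4
       - 8 * pwin L k - 8 * pwin L (ord_pred k)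
       + ptie L k + ptie L (ord_pred k)).
Proof.
have pE : pwin L (ord_pred k) = Ex (L k) (loses (L (ord_pred k))).
  by rewrite pwinE -Ex_loses_wins ord_predK.
have qE : qwin L (ord_pred k) = Ex (L k) (fun x => loses (L (ord_pred k)) x ^+ 2).
  by rewrite qwinE ord_predK.
have tE : ptie L (ord_pred k) = Ex (L k) (ties (L (ord_pred k))).
  by rewrite ptieE Ex_ties_swap ord_predK.
rewrite pE qE tE rwinE swinE pwinE ptieE /spread.
set a := wins _; set b := loses _; set u := ties (L (ordS k)); set u' := ties _.
have ba : bmeas a by exact: bmeas_wins. have bb : bmeas b by exact: bmeas_loses.
have bu : bmeas u by exact: bmeas_ties. have bu' : bmeas u' by exact: bmeas_ties.
have bZ (c : R) (g : R -> R) : bmeas g -> bmeas (fun x : R => c * g x).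
  by move=> bg; apply: bmeasM => //; exact: bmeas_cst.
have b1 := bZ 4 _ (bmeasX 2 ba); have b2 := bZ 4 _ (bmeasX 2 bb).
have b3 := bZ 8 _ (bmeasM bb ba); have b4 := bmeas_cst (T := R) (4 : R).
have b5 := bZ 8 _ ba; have b6 := bZ 8 _ bb.
have s2 := bmeasD b1 b2; have s3 := bmeasD s2 b3; have s4 := bmeasD s3 b4.
have s5 := bmeasB s4 b5; have s6 := bmeasB s5 b6; have s7 := bmeasD s6 bu.
have s8 := bmeasD s7 bu'.
apply: (@le_trans _ _ (Ex (L k) (fun x => 3 * (4 * a x ^+ 2 + 4 * b x ^+ 2 +
    8 * (b x * a x) + 4 - 8 * a x - 8 * b x + u x + u' x)))); last first.
  rewrite (ExZ _ 3 s8) (ExD _ s7 bu') (ExD _ s6 bu) (ExB _ s5 b6) (ExB _ s4 b5).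
  rewrite (ExD _ s3 b4) (ExD _ s2 b3) (ExD _ b1 b2) (ExZ _ 4 (bmeasX 2 ba)).
  by rewrite (ExZ _ 4 (bmeasX 2 bb)) (ExZ _ 8 (bmeasM bb ba)) (ExZ _ 8 ba) (ExZ _ 8 bb) Ex_cst.
apply: le_Ex; [|exact: bZ|].
  by apply: bmeasX; apply: bmeasB; exact: bmeas_adv.
move=> x; rewrite !adv_wins.
have := wins_loses_ties (L (ordS k)) x; have := wins_loses_ties (L (ord_pred k)) x.
have := ties_ge0 (L (ordS k)) x; have := ties_le1 (L (ordS k)) x.
have := ties_ge0 (L (ord_pred k)) x; have := ties_le1 (L (ord_pred k)) x.
rewrite -/a -/b -/u -/u'; set A := a x; set B := b x; set U := u x; set U' := u' x.
set c := loses _ x; set c' := wins _ x.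
move=> U'1 U'0 U1 U0 e1 e2.
have -> : c = 1 - A - U by rewrite -e2; ring.
have -> : c' = 1 - B - U' by rewrite -e1; ring.
have UU : U ^+ 2 <= U by rewrite expr2 ler_piMl.
have UU' : U' ^+ 2 <= U' by rewrite expr2 ler_piMl.
set V := 2 * A + 2 * B - 2.
have -> : A - (1 - A - U) - (1 - B - U' - B) = V + U + U' by rewrite /V; ring.
have -> : 4 * A ^+ 2 + 4 * B ^+ 2 + 8 * (B * A) + 4 - 8 * A - 8 * B + U + U' =
  V ^+ 2 + U + U' by rewrite /V; ring.
have := sqr_ge0 (V - U); have := sqr_ge0 (V - U'); have := sqr_ge0 (U - U'); nra.
Qed.

(** The advantage is [2A - 1 + U], and [2A - 1 >= -1], so its square is at least
    [(2A - 1)^2 - 2U]. *)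
Lemma variance_ge k :
  4 * rwin L k - 4 * pwin L k + 1 - 2 * ptie L k - edge L k ^+ 2 <= variance L k.
Proof.
have bA := bmeas_adv (L (ordS k)).
rewrite /variance /front Ex_sqr_centered// -/(edge L k) lerD2r rwinE pwinE ptieE.
set a := wins _; set u := ties _.
have ba : bmeas a by exact: bmeas_wins. have bu : bmeas u by exact: bmeas_ties.
have bZ (c : R) (g : R -> R) : bmeas g -> bmeas (fun x : R => c * g x).
  by move=> bg; apply: bmeasM => //; exact: bmeas_cst.
have b1 := bZ 4 _ (bmeasX 2 ba); have b2 := bZ 4 _ ba.
have b3 := bmeas_cst (T := R) (1 : R); have b4 := bZ 2 _ bu.
have s2 := bmeasB b1 b2; have s3 := bmeasD s2 b3; have s4 := bmeasB s3 b4.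
apply: (@le_trans _ _ (Ex (L k) (fun x => 4 * a x ^+ 2 - 4 * a x + 1 - 2 * u x))).
  rewrite (ExB _ s3 b4) (ExD _ s2 b3) (ExB _ b1 b2) (ExZ _ 4 (bmeasX 2 ba)).
  by rewrite (ExZ _ 4 ba) (ExZ _ 2 bu) Ex_cst.
apply: le_Ex => //; first exact: bmeasX.
move=> x; rewrite adv_wins.
have := wins_loses_ties (L (ordS k)) x.
have := ties_ge0 (L (ordS k)) x; have := ties_le1 (L (ordS k)) x.
have := wins_ge0 (L (ordS k)) x; have := wins_le1 (L (ordS k)) x.
rewrite -/a -/u; set A := a x; set U := u x; set c := loses _ x.
move=> A1 A0 U1 U0 e.
have -> : c = 1 - A - U by rewrite -e; ring.
nra.
Qed.

End moment_bounds.

Lemma cvg_sum_seq (R : realType) (I : Type) (s : seq I) (F : I -> nat -> R)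
    (a : I -> R) : (forall i, F i m @[m --> \oo] --> a i) ->
  \sum_(i <- s) F i m @[m --> \oo] --> \sum_(i <- s) a i.
Proof.
move=> Fa; elim: s => [|i s IHs].
  rewrite big_nil; under eq_fun do rewrite big_nil; exact: cvg_cst.
rewrite big_cons; under eq_fun do rewrite big_cons; exact: cvgD.
Qed.

Theorem theorem8 (R : realType) (l : nat) (hl : (3 <= l)%N)
  (d : nat -> measure_display) (T : forall m : nat, measurableType (d m))
  (P : forall m : nat, probability (T m) R)
  (n : nat -> 'I_l -> nat)
  (L : nat -> 'I_l -> probability R R)
  (D : forall (m : nat) (k : 'I_l), 'I_(n m k) -> {RV (P m) >-> R})
  (f : nat -> 'I_l -> R)
  (f_oo p_oo sigma_oo gamma_oo : 'I_l -> R)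
  (hD : forall m : nat, independent_random_dice (L m) (D m))
  (hn : forall (m : nat) (k : 'I_l), (n m k <= m)%N)
  (hf : forall (m : nat) (k : 'I_l), f m k = (n m k)%:R / m%:R)
  (hi : forall k : 'I_l,
     f m k @[m --> \oo] --> f_oo k /\ 0 < f_oo k <= 1)
  (hii_p : forall k : 'I_l,
     pwin (L m) k @[m --> \oo] --> p_oo k /\ 0 < p_oo k <= 1)
  (hii_sigma : forall k : 'I_l,
     sigma (f m) (L m) k @[m --> \oo] --> sigma_oo k /\ 0 < sigma_oo k)
  (hii_gamma : forall k : 'I_l,
     gamma (f m) (L m) k @[m --> \oo] --> gamma_oo k /\
     -1 <= gamma_oo k <= 1)
  (hiii : forall k : 'I_l, ptie (L m) k @[m --> \oo] --> (0 : R))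
  (hiv : forall k : 'I_l,
     (fun m : nat => 2^-1 - pwin (L m) k - 2^-1 * ptie (L m) k : R^o)
       =o_\oo (fun m : nat => m%:R `^ (- 2^-1) : R^o))
  (hv_p : forall k : 'I_l, pwin (L m) k @[m --> \oo] --> (2^-1 : R))
  (hv_q : forall k : 'I_l, qwin (L m) k @[m --> \oo] --> (3^-1 : R))
  (hv_r : forall k : 'I_l, rwin (L m) k @[m --> \oo] --> (3^-1 : R))
  (hv_s : forall k : 'I_l, swin (L m) k @[m --> \oo] --> (6^-1 : R)) :
  P m [set w | forall k : 'I_l,
         die_beats (fun i => D m k i w) (fun j => D m (ordS k) j w)]
    @[m --> \oo] --> 0%E.
Proof.
have sqrt_gt0 (m : nat) : (0 < m)%N -> 0 < Num.sqrt (m%:R : R).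
  by move=> m0; rewrite sqrtr_gt0 ltr0n.
have edge0 k : Num.sqrt m%:R * edge (L m) k @[m --> \oo] --> (0 : R).
  apply/cvgr0Pnorm_le => eps eps0.
  have eps2 : 0 < eps / 2 by rewrite divr_gt0.
  have /eqoP/(_ _ eps2) := hiv k; apply: filterS2 (nbhs_infty_gt 0) => m m0.
  rewrite powRN powR12_sqrt// => h.
  have q0 := sqrt_gt0 _ m0.
  have -> : Num.sqrt m%:R * edge (L m) k =
     - 2 * (Num.sqrt m%:R * (2^-1 - pwin (L m) k - 2^-1 * ptie (L m) k)).
    by rewrite edgeE; field.
  rewrite !normrM normrN (ger0_norm (ltW q0)) (ger0_norm (_ : 0 <= 2))//.
  move: h; rewrite normfV (ger0_norm (ltW q0)) ler_pdivlMr//; lra.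
have edge2 k : edge (L m) k @[m --> \oo] --> (0 : R).
  have : 2 * pwin (L m) k - 1 + ptie (L m) k @[m --> \oo] --> (2 * 2^-1 - 1 + 0 : R).
    apply: cvgD => //; apply: cvgB; last exact: cvg_cst.
    by apply: cvgM => //; exact: cvg_cst.
  rewrite mulfV// subrr addr0; apply: cvg_trans; apply: near_eq_cvg.
  by apply: nearW => m; rewrite edgeE.
have spread0 k : spread (L m) k @[m --> \oo] --> (0 : R).
  pose ub m : R := 3 * (4 * rwin (L m) k + 4 * qwin (L m) (ord_pred k) +
    8 * swin (L m) k + 4 - 8 * pwin (L m) k - 8 * pwin (L m) (ord_pred k)
    + ptie (L m) k + ptie (L m) (ord_pred k)).
  (* The values [1/2], [1/3], [1/6] cancel exactly: [4/3 + 4/3 + 8/6 + 4 - 4 - 4 = 0]. *)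
  have ub0 : ub m @[m --> \oo] --> (0 : R).
    have -> : (0 : R) = 3 * (4 * 3^-1 + 4 * 3^-1 + 8 * 6^-1 + 4 - 8 * 2^-1
      - 8 * 2^-1 + 0 + 0) by field.
    apply: cvgM; first exact: cvg_cst.
    do 2 (apply: cvgD; last exact: hiii).
    do 2 (apply: cvgB; last by apply: cvgM; [exact: cvg_cst|exact: hv_p]).
    apply: cvgD; last exact: cvg_cst.
    by repeat apply: cvgD; apply: cvgM => //; exact: cvg_cst.
  apply: (squeeze_cvgr _ (cvg_cst 0) ub0); apply: nearW => m.
  by rewrite spread_ge0 spread_le.
have var0 k : \forall m \near \oo, 4^-1 <= variance (L m) k.
  pose lb m : R := 4 * rwin (L m) k - 4 * pwin (L m) k + 1 - 2 * ptie (L m) k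
    - edge (L m) k * edge (L m) k.
  (* The limiting variance is at least [4/3 - 2 + 1 = 1/3], which leaves room above [1/4]. *)
  have lb0 : lb m @[m --> \oo] --> (3^-1 : R).
    have -> : (3^-1 : R) = 4 * 3^-1 - 4 * 2^-1 + 1 - 2 * 0 - 0 * 0 by field.
    apply: cvgB; last by apply: cvgM; exact: edge2.
    apply: cvgB; last by apply: cvgM; [exact: cvg_cst|exact: hiii].
    apply: cvgD; last exact: cvg_cst.
    by apply: cvgB; apply: cvgM => //; exact: cvg_cst.
  have lt : (4^-1 : R) < 3^-1 by lra.
  apply: filterS (cvgr_ge _ lb0 _ lt) => m h; apply: le_trans h _.
  by rewrite /lb -expr2 variance_ge.
have isqrt0 : (Num.sqrt (m%:R : R))^-1 @[m --> \oo] --> (0 : R).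
  apply/cvgr0Pnorm_le => eps eps0.
  apply: filterS2 (nbhs_infty_gt 0) (nbhs_infty_ger (eps ^- 2)) => m m0 em.
  have q0 := sqrt_gt0 _ m0.
  rewrite normfV (ger0_norm (ltW q0)) -[eps]invrK lef_pV2 ?posrE ?invr_gt0//.
  rewrite -(ler_pXn2r (n := 2)) ?nnegrE ?invr_ge0 ?(ltW q0) ?(ltW eps0)//.
  by rewrite exprVn sqr_sqrtr.
have inv0 : (m%:R : R)^-1 @[m --> \oo] --> (0 : R).
  rewrite -(mulr0 (0 : R)); apply: cvg_trans (cvgM isqrt0 isqrt0).
  apply: near_eq_cvg; apply: nearW => m.
  by rewrite /= -invfM -expr2 sqr_sqrtr.
have ratio k : m%:R / (n m k)%:R @[m --> \oo] --> (f_oo k)^-1.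
  have [fk /andP[fpos _]] := hi k.
  apply: cvg_trans (cvgV (lt0r_neq0 fpos) fk); apply: near_eq_cvg.
  by apply: nearW => m; rewrite /= hf invf_div.
have npos k : \forall m \near \oo, (0 < n m k)%N.
  have [fk /andP[fpos _]] := hi k.
  apply: filterS (cvgr_gt _ fk _ fpos) => m.
  by rewrite hf lt0n; case: eqP => // ->; rewrite mul0r ltxx.
have freq0 k : Num.sqrt m%:R / (n m k)%:R @[m --> \oo] --> (0 : R).
  have : m%:R / (n m k)%:R * (Num.sqrt m%:R)^-1 @[m --> \oo] --> ((f_oo k)^-1 * 0 : R).
    exact: cvgM.
  rewrite mulr0; apply: cvg_trans; apply: near_eq_cvg.
  apply: filterS2 (nbhs_infty_gt 0) (npos k) => m m0 nk.
  have q0 := sqrt_gt0 _ m0; set q := Num.sqrt _ in q0 *.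
  have -> : m%:R = q ^+ 2 :> R by rewrite sqr_sqrtr.
  by field; rewrite pnatr_eq0 -lt0n nk gt_eqF.
have cell0 k : m%:R / ((n m k)%:R * (n m (ordS k))%:R) @[m --> \oo] --> (0 : R).
  have : m%:R / (n m k)%:R * (m%:R / (n m (ordS k))%:R) * m%:R^-1
      @[m --> \oo] --> ((f_oo k)^-1 * (f_oo (ordS k))^-1 * 0 : R).
    by apply: cvgM => //; apply: cvgM.
  rewrite mulr0; apply: cvg_trans; apply: near_eq_cvg.
  apply: filterS3 (nbhs_infty_gt 0) (npos k) (npos (ordS k)) => m m0 n0 n0'.
  by field; rewrite !pnatr_eq0 -!lt0n m0 n0 n0'.
pose tot m : R := l%:R * \sum_k 3 * (edge (L m) k ^+ 2 + spread (L m) k / (n m k)%:R +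
    16 / ((n m k)%:R * (n m (ordS k))%:R)).
(* The factor [m] splits so that each term vanishes: [sqrt m * edge] squared, the bounded ratio
   [m / n] times [spread], and [m / (n * n')], of order [1/m]. *)
have tot0 : m%:R * tot m @[m --> \oo] --> (0 : R).
  have : l%:R * \sum_(k <- index_enum 'I_l) 3 * ((Num.sqrt m%:R * edge (L m) k) * (Num.sqrt m%:R * edge (L m) k)
      + m%:R / (n m k)%:R * spread (L m) k
      + 16 * (m%:R / ((n m k)%:R * (n m (ordS k))%:R)))
      @[m --> \oo] --> (l%:R * \sum_(k <- index_enum 'I_l) (3 * (0 * 0 + (f_oo k)^-1 * 0 + 16 * 0)) : R).
    apply: cvgM; first exact: cvg_cst.
    apply: cvg_sum_seq => k; apply: cvgM; first exact: cvg_cst.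
    apply: cvgD; last by apply: cvgM; [exact: cvg_cst|exact: cell0].
    by apply: cvgD; apply: cvgM.
  rewrite [X in l%:R * X]big1 ?mulr0; last by move=> k _; rewrite !mulr0 !addr0 mulr0.
  apply: cvg_trans; apply: near_eq_cvg; apply: nearW => m.
  rewrite /tot mulrCA; congr (_ * _); rewrite mulr_sumr; apply: eq_bigr => k _.
  have qq : Num.sqrt m%:R * Num.sqrt m%:R = m%:R :> R by rewrite -expr2 sqr_sqrtr.
  by rewrite mulrACA qq; ring.
pose k0 : 'I_l := Ordinal (ltn_trans (isT : 0 < 2)%N hl).
apply/fine_cvgP; split.
  apply: filterS (filter_forall _ npos) => m n0.
  by apply: fin_num_measure; exact: measurable_all_beat.
apply/cvgr0Pnorm_le => eps eps0.
(* [N] is fixed before [m] is taken large: it makes the small ball term at most [eps / 3], and the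
   other two terms then vanish with [N] constant. *)
have [N N0 NE] : exists2 N : nat, (0 < N)%N & 8 / N%:R <= eps / 3.
  have e24 : 0 < 24 / eps by rewrite divr_gt0.
  have hN := archi_boundP (ltW e24); set N := Num.Def.archi_bound _ in hN.
  have NR : 0 < N%:R :> R := lt_trans e24 hN.
  exists N; first by rewrite -(ltr0n R).
  move: hN; rewrite ler_pdivrMr// ltr_pdivrMr//; lra.
set C : R := (12 * N%:R ^+ 2) ^+ 2.
have eps3 : 0 < eps / 3 by rewrite divr_gt0.
have near1 : \forall m \near \oo, C * (m%:R * tot m) <= eps / 3.
  have : C * (m%:R * tot m) @[m --> \oo] --> (C * 0 : R).
    by apply: cvgM => //; exact: cvg_cst.
  rewrite mulr0 => /cvgr0_norm_le /(_ _ eps3).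
  by apply: filterS => m; apply: le_trans; exact: ler_norm.
have near2 : \forall m \near \oo,
    C * 16 * (m%:R / ((n m k0)%:R * (n m (ordS k0))%:R)) <= eps / 3.
  have : C * 16 * (m%:R / ((n m k0)%:R * (n m (ordS k0))%:R)) @[m --> \oo] -->
      (C * 16 * 0 : R) by apply: cvgM => //; exact: cvg_cst.
  rewrite mulr0 => /cvgr0_norm_le /(_ _ eps3).
  by apply: filterS => m; apply: le_trans; exact: ler_norm.
have near3 : \forall m \near \oo,
    8 * N%:R ^+ 2 * Num.sqrt m%:R / (n m k0)%:R <= (5^-1 : R).
  have : 8 * N%:R ^+ 2 * (Num.sqrt m%:R / (n m k0)%:R) @[m --> \oo] -->
      (8 * N%:R ^+ 2 * 0 : R) by apply: cvgM => //; exact: cvg_cst.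
  rewrite mulr0 => /cvgr0_norm_le /(_ _ (_ : 0 < 5^-1)); rewrite invr_gt0 ltr0n.
  move=> /(_ isT); apply: filterS => m; rewrite mulrA.
  by apply: le_trans; exact: ler_norm.
have near4 : \forall m \near \oo,
    12 * N%:R ^+ 2 * Num.sqrt m%:R * `|edge (L m) k0| <= 1.
  have : 12 * N%:R ^+ 2 * (Num.sqrt m%:R * edge (L m) k0) @[m --> \oo] -->
      (12 * N%:R ^+ 2 * 0 : R) by apply: cvgM => //; exact: cvg_cst.
  rewrite mulr0 => /cvgr0_norm_le /(_ _ ltr01); apply: filterS => m.
  rewrite mulrA normrM ger0_norm// mulr_ge0 ?sqrtr_ge0// mulr_ge0// sqr_ge0.
near=> m.
have m0 : (0 < m)%N by near: m; exact: nbhs_infty_gt.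
have n0 : forall k, (0 < n m k)%N by near: m; exact: filter_forall.
rewrite ger0_norm ?fine_ge0//=.
have mR : 0 < m%:R :> R by rewrite ltr0n.
have nmR : (n m k0)%:R <= m%:R :> R by rewrite ler_nat.
have h3 : 8 * N%:R ^+ 2 * Num.sqrt m%:R / (n m k0)%:R <= (5^-1 : R) by near: m.
have h4 : 12 * N%:R ^+ 2 * Num.sqrt m%:R * `|edge (L m) k0| <= 1 by near: m.
have hv : 4^-1 <= variance (L m) k0 by near: m; exact: var0.
apply: le_trans (all_beat_le hl (hD m) n0 N0 mR nmR h3 hv h4) _.
have -> : eps = eps / 3 + eps / 3 + eps / 3 by field.
have C0 : 0 <= C * m%:R by rewrite mulr_ge0// sqr_ge0.
apply: lerD => //; apply: lerD.
  apply: (@le_trans _ _ (C * (m%:R * tot m))); last by near: m.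
  by rewrite mulrA ler_wpM2l// Ex_sqr_sum_duel.
apply: (@le_trans _ _ (C * 16 * (m%:R / ((n m k0)%:R * (n m (ordS k0))%:R)))); last by near: m.
apply: le_trans (ler_wpM2l C0 (Ex_sqr_residue hl (hD m) n0 k0)) _.
by rewrite le_eqVlt; apply/orP; left; apply/eqP; ring.
Unshelve. all: by end_near.
Qed.
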